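(* Let $\Sigma\subset\mathbb{R}^2$ be a bounded smooth domain. There exists a constant $C>0$, independent of $\Phi$ and $\alpha$, such that for every flux $\Phi\ge0$ and every friction ratio $\alpha\ge0$ the Poiseuille flow profile $P_\Phi$ (with friction ratio $\alpha$ and flux $\Phi$) satisfies $$\|\nabla P_\Phi\|_{L^2(\Sigma)}\le\frac{C\alpha\Phi}{1+\alpha}.$$
   Context: For $\alpha\ge0$ and $\Phi\ge0$, the Poiseuille flow profile is the scalar function $P_\Phi:\Sigma\to\mathbb{R}$ solving: $-\Delta_hP_\Phi$ is equal to some constant in $\Sigma$ (the constant being part of the unknowns), $\frac{\partial P_\Phi}{\partial\bar{\boldsymbol{n}}}=-\alpha P_\Phi$ on $\partial\Sigma$, and $\int_\Sigma P_\Phi(x_h)\,dx_h=\Phi$. Here $x_h=(x_1,x_2)$, $\Delta_h=\partial_{x_1}^2+\partial_{x_2}^2$, and $\bar{\boldsymbol{n}}$ is the unit outer normal on $\partial\Sigma$. The constant $C$ may depend on $\Sigma$. *)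

(* Defs.v *)
From HB Require Import structures.
From mathcomp Require Import all_boot all_order all_algebra.
From mathcomp Require Import all_classical all_reals all_analysis.

Set Implicit Arguments.
Unset Strict Implicit.
Unset Printing Implicit Defensive.
Import Order.TTheory GRing.Theory Num.Theory.
Import numFieldNormedType.Exports.
Local Open Scope classical_set_scope.
Local Open Scope ring_scope.

(* Points of the plane are pairs; the two coordinate axes are indexed by [bool],
   [false] standing for x_1 and [true] for x_2. *)
Definition coordinate (R : realType) (b : bool) (x : R * R) : R :=
  if b then x.2 else x.1.

Definition axis (R : realType) (b : bool) : R * R :=
  if b then (0, 1) else (1, 0).

Definition partial (R : realType) (b : bool) (f : R * R -> R) : R * R -> R :=
  fun x => 'D_(axis R b) f x.

Definition laplacian (R : realType) (f : R * R -> R) (x : R * R) : R :=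
  partial false (partial false f) x + partial true (partial true f) x.

Definition grad_norm (R : realType) (f : R * R -> R) (x : R * R) : R :=
  Num.sqrt (partial false f x ^+ 2 + partial true f x ^+ 2).

Definition lebesgue2 (R : realType) :=
  ((@lebesgue_measure R) \x (@lebesgue_measure R))%E.

Definition L2norm_grad (R : realType) (S : set (R * R)) (f : R * R -> R)
    : \bar R :=
  Lnorm (@lebesgue2 R) 2%:E ((fun x => (grad_norm f x)%:E) \_ S).

Definition frontier (R : realType) (S : set (R * R)) : set (R * R) :=
  closure S `\` interior S.

Definition smooth (R : realType) (g : R -> R) : Prop :=
  forall n t, derivable (derive1n n g) t 1.

(* Near its point [x], the boundary of [S] is the graph of the smooth function
   [g], the coordinate [b] being expressed in terms of the other one, and [S]
   lies above the graph if [s = false], below it if [s = true]. *)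
Definition boundary_chart (R : realType) (S : set (R * R)) (x : R * R)
    (b s : bool) (g : R -> R) : Prop :=
  [/\ smooth g,
      coordinate b x = g (coordinate (~~ b) x) &
      \forall y \near x,
        S y <-> 0 < (-1) ^+ s * (coordinate b y - g (coordinate (~~ b) y))].

Definition bounded_smooth_domain (R : realType) (S : set (R * R)) : Prop :=
  [/\ S !=set0, open S, connected S, bounded_set S &
      forall x, frontier S x -> exists b s g, boundary_chart S x b s g].

(* In a chart, [S] is locally the set where (-1)^s (x_b - g) is positive; the
   unit outer normal is minus the normalised gradient of this function. *)
Definition unit_outer_normal (R : realType) (S : set (R * R)) (x n : R * R)
    : Prop :=
  exists b s g,
    [/\ boundary_chart S x b s g,
        coordinate b n =
          - (-1) ^+ s / Num.sqrt (1 + derive1 g (coordinate (~~ b) x) ^+ 2) &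
        coordinate (~~ b) n =
          (-1) ^+ s * derive1 g (coordinate (~~ b) x)
            / Num.sqrt (1 + derive1 g (coordinate (~~ b) x) ^+ 2)].

Definition C1_in (R : realType) (S : set (R * R)) (f : R * R -> R) : Prop :=
  forall x, S x ->
    {for x, continuous f} /\
    forall b, derivable f x (axis R b) /\ {for x, continuous (partial b f)}.

Definition C2_in (R : realType) (S : set (R * R)) (f : R * R -> R) : Prop :=
  C1_in S f /\ forall b, C1_in S (partial b f).

(* [f] and its first partial derivatives on [S] extend continuously to the
   closure of [S]; values of [f] outside the closure are irrelevant. *)
Definition C1_up_to_boundary (R : realType) (S : set (R * R))
    (f : R * R -> R) : Prop :=
  [/\ C1_in S f,
      {within closure S, continuous f} &
      forall b x, closure S x -> cvg (partial b f @ within S (nbhs x))].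

(* The gradient of [f] at a boundary point [x] is the limit of its values
   inside [S]. *)
Definition normal_derivative (R : realType) (S : set (R * R))
    (f : R * R -> R) (x n : R * R) : R :=
  n.1 * lim (partial false f @ within S (nbhs x)) +
  n.2 * lim (partial true f @ within S (nbhs x)).

Definition poiseuille_profile (R : realType) (S : set (R * R))
    (alpha Phi : R) (P : R * R -> R) : Prop :=
  [/\ C2_in S P,
      C1_up_to_boundary S P,
      exists c : R, forall x, S x -> - laplacian P x = c,
      forall x n, frontier S x -> unit_outer_normal S x n ->
        normal_derivative S P x n = - (alpha * P x) &
      (\int[@lebesgue2 R]_(x in S) (P x)%:E = Phi%:E)%E].

(* Main.v *)
Require Import Defs.
From HB Require Import structures.
From mathcomp Require Import all_boot all_order all_algebra.
From mathcomp Require Import all_classical all_reals all_analysis.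
From mathcomp Require Import measurable_realfun ring lra.

(** Write [c] for the constant [- laplacian P], [E] for the Dirichlet energy of
    [P] and [Phi] for its integral. Formally, testing the equation with [P],
    with a fixed function vanishing on the boundary and with [1] gives
    [E <= c * Phi], [c <= C * Phi] and [c <= C * alpha * boundary mean of P];
    the first two settle [alpha] bounded below. For small [alpha] one tests with
    [P - k], where [k] is a mean value of [P]: the terms [c * (P - k)] and
    [alpha * P * (P - k)] are absorbed with the Poincare inequality, which leaves
    [E <= C * (c^2 + alpha^2 * k^2) <= C' * alpha^2 * Phi^2].

    No surface measure is used. The domain is written as [{h > 0}] for a C2
    function [h] with nonzero gradient on the boundary, and the divergence theorem
    takes the form: if the limit of [Y . grad h] at the boundary is nonnegative,
    then the integral of [div Y] is nonpositive. It follows by cutting [Y] off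
    with a function of [h / e] and letting [e] tend to [0]. The Robin condition
    enters through the field [grad P - alpha * P * zeta], where [zeta] is a
    multiple of [grad h] whose flux through the boundary is [-1], so that this
    field has no flux. *)

(** The obstacle is regularity. [P] is C2 only inside the domain and C1 up to the boundary, so its
    second derivatives may be unbounded near the boundary while their trace, the Laplacian, is
    constant. The divergence inequality therefore asks for bounds on the field and on its divergence
    only, and products with the cutoff are differentiated where everything is C1.

    One-sided inequalities suffice: every flux met is either zero or of the favourable sign, and a
    field without flux may be multiplied by a weight of any sign.

    Replacing boundary integrals by volume integrals through [zeta] also takes the place of a trace
    theorem. The price is terms of size [alpha] times the squares of [P - k] and [grad P], which can
    be absorbed only below a threshold depending on the domain. Above it, [alpha / (1 + alpha)] is
    bounded below and [E <= C * Phi^2] is all that is needed.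

    Outer normals are defined through charts, and two charts might a priori give different normals
    at a point. The geometric part only ever uses that their scalar product is nonnegative. *)

Set Implicit Arguments.
Unset Strict Implicit.
Unset Printing Implicit Defensive.
Import Order.TTheory GRing.Theory Num.Theory.
Import numFieldNormedType.Exports.
Local Open Scope classical_set_scope.
Local Open Scope ring_scope.

(** * C1 functions of two variables *)

Section Calculus.
Variable R : realType.
Implicit Types (S : set (R * R)) (f g : R * R -> R) (x v : R * R).

Lemma derive_line (f : R * R -> R) x v :
  'D_v f x = 'D_1 (fun t : R => f (t *: v + x)) 0.
Proof.
rewrite /derive.
set F := fun h => _; set G := fun h => _.
suff -> : F = G by [].
by apply/funext => h; rewrite /F /G /= scale0r add0r addr0 [h *: 1]mulr1.
Qed.

Lemma is_derive_line f x v (d : R) :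
  is_derive x v f d <-> is_derive (0 : R) 1 (fun t : R => f (t *: v + x)) d.
Proof.
have dP := @derivable1P R _ _ f x v.
split=> -[df dv]; split.
- exact: dP.1 df.
- by rewrite -derive_line.
- exact: dP.2 df.
- by rewrite derive_line.
Qed.

Lemma is_derive_comp (phi : R -> R) f x v (a d : R) :
  is_derive (f x) 1 phi a -> is_derive x v f d ->
  is_derive x v (phi \o f) (a * d).
Proof.
move=> dphi /is_derive_line df; apply/is_derive_line.
apply: (@is_derive1_comp _ phi (fun t => f (t *: v + x))).
by rewrite scale0r add0r.
Qed.

(** The gradient is explicit data rather than [partial f], so that gradients and divergences of
    composite fields come out as formulas on which [ring] works. *)
Definition C1grad S f (G : bool -> R * R -> R) :=
  forall x, S x -> {for x, continuous f} /\
    forall b, is_derive x (axis R b) f (G b x) /\ {for x, continuous (G b)}.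

Lemma C1grad_cst S (k : R) : C1grad S (fun=> k) (fun _ _ => 0).
Proof.
move=> x _; split; first exact: cst_continuous.
move=> b; split; last exact: cst_continuous.
exact: is_derive_cst.
Qed.

Lemma C1gradD S f g F G : C1grad S f F -> C1grad S g G ->
  C1grad S (fun x => f x + g x) (fun b x => F b x + G b x).
Proof.
move=> Cf Cg x Sx; have [cf df] := Cf x Sx; have [cg dg] := Cg x Sx.
split; first exact: continuousD.
move=> b; have [df1 cF] := df b; have [dg1 cG] := dg b.
by split; [exact: is_deriveD|exact: continuousD].
Qed.

Lemma C1gradM S f g F G : C1grad S f F -> C1grad S g G ->
  C1grad S (fun x => f x * g x) (fun b x => f x * G b x + F b x * g x).
Proof.
move=> Cf Cg x Sx; have [cf df] := Cf x Sx; have [cg dg] := Cg x Sx.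
split; first exact: continuousM.
move=> b; have [df1 cF] := df b; have [dg1 cG] := dg b.
split; last by apply: continuousD; exact: continuousM.
by apply: is_derive_eq; rewrite [F b x * _]mulrC.
Qed.

Lemma C1grad_comp S f F (phi dphi : R -> R) :
  (forall x, S x -> is_derive (f x) 1 phi (dphi (f x)) /\
    {for f x, continuous dphi}) ->
  C1grad S f F -> C1grad S (fun x => phi (f x)) (fun b x => dphi (f x) * F b x).
Proof.
move=> Cphi Cf x Sx; have [cf df] := Cf x Sx; have [dp cp] := Cphi x Sx.
split.
  apply: (@continuous_comp _ _ _ f phi) => //.
  by apply: differentiable_continuous; apply/derivable1_diffP; case: dp.
move=> b; have [df1 cF] := df b; split; first exact: is_derive_comp.
by apply: continuousM => //; exact: (@continuous_comp _ _ _ f dphi).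
Qed.

Lemma C1gradN S f F : C1grad S f F ->
  C1grad S (fun x => - f x) (fun b x => - F b x).
Proof.
move=> Cf x Sx; have [cf df] := Cf x Sx.
split; first exact: continuousN.
move=> b; have [df1 cF] := df b; split; last exact: continuousN.
exact: is_deriveN.
Qed.

Lemma C1gradB S f g F G : C1grad S f F -> C1grad S g G ->
  C1grad S (fun x => f x - g x) (fun b x => F b x - G b x).
Proof. by move=> Cf Cg; apply: C1gradD => //; exact: C1gradN. Qed.

Lemma C1gradZ S (k : R) f F : C1grad S f F ->
  C1grad S (fun x => k * f x) (fun b x => k * F b x).
Proof.
move=> Cf x Sx; have [cf df] := Cf x Sx.
split; first by apply: continuousM => //; exact: cst_continuous.
move=> b; have [df1 cF] := df b.
split; last by apply: continuousM => //; exact: cst_continuous.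
exact: is_deriveZ.
Qed.

Lemma C1gradV S f F : (forall x, S x -> f x != 0) -> C1grad S f F ->
  C1grad S (fun x => (f x)^-1) (fun b x => - (f x)^-1 ^+ 2 * F b x).
Proof.
move=> f0 Cf.
apply: (@C1grad_comp S f F GRing.inv (fun y => - y^-1 ^+ 2)) => // x Sx.
have fx0 := f0 x Sx; split.
  split; first by apply: (@derivableV _ _ id).
  by rewrite (@deriveV _ _ id)// derive_id [_ *: 1]mulr1 exprVn.
apply: cvgN; apply: cvgM; exact: cvgV.
Qed.

Lemma C1grad_eq S f f' F F' : open S -> (forall x, S x -> f x = f' x) ->
  (forall b x, S x -> F b x = F' b x) -> C1grad S f F -> C1grad S f' F'.
Proof.
move=> oS ff' FF' Cf x Sx; have [cf df] := Cf x Sx.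
have Sn : \forall y \near x, S y by exact: open_nbhs_nbhs.
split.
  rewrite /prop_for /continuous_at -(ff' x Sx).
  by apply: cvg_trans cf; apply: near_eq_cvg; near do rewrite ff'//.
move=> b; have [df1 cF] := df b; split.
  rewrite -(FF' b x Sx); apply: near_eq_is_derive df1.
    by near do rewrite ff'//.
rewrite /prop_for /continuous_at -(FF' b x Sx).
by apply: cvg_trans cF; apply: near_eq_cvg; near do rewrite FF'//.
Unshelve. all: by end_near. Qed.

Lemma C1grad_sub S S' f F : S' `<=` S -> C1grad S f F -> C1grad S' f F.
Proof. by move=> SS Cf x /SS; exact: Cf. Qed.

Lemma C1_inP S f : C1_in S f <-> C1grad S f (fun b => partial b f).
Proof.
split=> Cf x Sx; have [cf df] := Cf x Sx; split=> // b; have [? ?] := df b.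
  by split=> //; exact: derivableP.
by split=> //; apply: ex_derive.
Qed.

Lemma C1grad_coord S (b : bool) :
  C1grad S (coordinate b) (fun b' _ => (b == b')%:R).
Proof.
move=> x _; split.
  by case: b; [exact: cvg_snd|exact: cvg_fst].
move=> b'; split; last exact: cst_continuous.
apply/is_derive_line.
have -> : (fun t => coordinate b (t *: axis R b' + x)) =
  (fun t => t * (b == b')%:R + coordinate b x).
  by apply/funext => t; case: b; case: b'; rewrite /= -?[_ *: _]/(_ * _).
apply: is_derive_eq.
by rewrite scaler0 add0r addr0 [_ *: 1]mulr1.
Qed.

End Calculus.

(** * Compactness *)

(* [F] consists of the families of sets that contain every large enough set
   satisfying [Q], so that near-coverings give a single such set. *)
Lemma compact_induction (X : topologicalType) (Q : set X -> Prop) (K : set X) :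
  (forall A B, A `<=` B -> Q B -> Q A) ->
  Q set0 -> (forall A B, Q A -> Q B -> Q (A `|` B)) ->
  compact K -> (forall x, K x -> exists2 U, nbhs x U & Q U) -> Q K.
Proof.
move=> Qs Q0 QU /compact_near_coveringP Kc Qloc.
pose F : set_system (set X) :=
  fun Z => exists2 A, Q A & forall B, A `<=` B -> Q B -> Z B.
have FF : Filter F.
  split=> [|Z Z' [A QA AZ] [A' QA' AZ']|Z Z' ZZ' [A QA AZ]].
  - by exists set0.
  - exists (A `|` A'); first exact: QU.
    by move=> B; rewrite subUset => -[AB A'B] QB; split; [exact: AZ|exact: AZ'].
  - by exists A => // B AB QB; apply/ZZ'/AZ.
have [A QA KA] : \forall B \near F, K `<=` B.
  apply: (Kc _ F (fun B => B)) => x /Qloc[U xU QU'].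
  exists (U, [set B | U `<=` B]) => /=; last by move=> -[y B]/= [Uy UB]; exact: UB.
  by split=> //; exists U.
exact: Qs (KA A (@subset_refl _ A) QA) QA.
Qed.

Section Plane.
Variable R : realType.
Implicit Types (S : set (R * R)) (f g : R * R -> R) (x v : R * R).

(** Balls of the product are open squares; this is what allows them to be sliced along both axes
    later. *)
Lemma in_ball (x y : R * R) (r : R) :
  ball x r y <-> `|x.1 - y.1| < r /\ `|x.2 - y.2| < r.
Proof. by []. Qed.

Lemma bounded_ball2 (a : R * R) (r : R) : bounded_set (ball a r).
Proof.
exists (`|a| + r); split; first exact: num_real.
move=> M aM x; rewrite prod_norm_ball /ball_/= => ax.
have := ler_normD a (x - a); rewrite addrC subrK => /le_trans; apply.
by rewrite distrC; lra.
Qed.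

Lemma bounded_sub_ball S : bounded_set S ->
  exists2 M : R, 0 < M & S `<=` ball (0 : R * R) M.
Proof.
move=> [M [Mr SM]]; exists (`|M| + 2); first by rewrite ltr_wpDl.
move=> x Sx; rewrite prod_norm_ball /ball_/= sub0r normrN.
have : `|x| <= `|M| + 1 by apply: SM => //; rewrite ltr_pwDr// ler_norm.
lra.
Qed.

Lemma bounded_closure_compact S : bounded_set S -> compact (closure S).
Proof.
move=> /bounded_sub_ball[N _ SN].
have cN : compact (`[- N, N]%classic `*` `[- N, N]%classic : set (R * R)).
  by apply: compact_setX; exact: segment_compact.
apply: (subclosed_compact _ cN); first exact: closed_closure.
have clN := compact_closed (@norm_hausdorff _ _) cN.
suff : S `<=` `[- N, N]%classic `*` `[- N, N]%classic.
  by move/closure_subset; move/closure_id: clN => <-.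
move=> x /SN/in_ball[/=]; rewrite !sub0r !normrN !ltr_norml.
by move=> /andP[? ?] /andP[? ?]; split; rewrite /= in_itv/=; apply/andP; split;
  exact: ltW.
Qed.

End Plane.

(** * Lebesgue measure on the plane *)

Section Measure.
Variable R : realType.
Local Notation RR := (measurableTypeR R * measurableTypeR R)%type.
Local Notation mu1 := (@lebesgue_measure R).
Local Notation mu2 := (mu1 \x mu1)%E.
Implicit Types (S : set (R * R)) (f g : R * R -> R) (x v : R * R).

(** The sigma-algebra is generated by rectangles, so [S] is exhibited as the union of the rational
    boxes it contains. Boxes not inside [S] are replaced by the empty set, which keeps the index set
    countable. *)
Lemma open_measurable2 S : open S -> measurable (S : set RR).
Proof.
move=> oS.
pose box (q : rat * rat * rat * rat) : set (R * R) :=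
  `]ratr q.1.1.1, ratr q.1.1.2[%classic `*` `]ratr q.1.2, ratr q.2[%classic.
pose F q : set RR := if pselect (box q `<=` S) then box q else set0.
suff -> : S = \bigcup_q F q.
  apply: countable_bigcupT_measurable => // q; rewrite /F.
  by case: pselect => ? //=; apply: measurableX; exact: measurable_itv.
apply/seteqP; split=> [x Sx|x [q _]]; last first.
  by rewrite /F; case: pselect => //= h; exact: h.
have /nbhs_ballP[e/= e0 xeS] : nbhs x S by exact: open_nbhs_nbhs.
have lte (y : R) : y - e < y by rewrite ltrBlDr ltrDl.
have gte (y : R) : y < y + e by rewrite ltrDl.
have [a ha] := rat_in_itvoo (lte x.1); have [a' ha'] := rat_in_itvoo (gte x.1).
have [c hc] := rat_in_itvoo (lte x.2); have [c' hc'] := rat_in_itvoo (gte x.2).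
move: ha ha' hc hc';
  rewrite !in_itv/= => /andP[a1 a2] /andP[a3 a4] /andP[c1 c2] /andP[c3 c4].
exists (a, a', c, c') => //; rewrite /F; case: pselect => [?|[]] /=.
  by split; rewrite /= in_itv/= ?a2 ?a3 ?c2 ?c3.
move=> y [] /=; rewrite !in_itv/= => /andP[y1 y2] /andP[y3 y4].
apply: xeS; split; rewrite /ball/= ltr_norml; apply/andP; split; lra.
Qed.

Lemma measurable_fun_continuous2 S f : open S ->
  (forall x, S x -> {for x, continuous f}) ->
  measurable_fun (S : set RR) (f : RR -> R).
Proof.
move=> oS cf; apply: (measurability _ (RGenOInfty.measurableE R)) => //=.
move=> _ [_ [a ->]] <-; apply: open_measurable2.
rewrite openE => x [Sx fx]; apply: filterI.
  exact: open_nbhs_nbhs.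
apply: (cf x Sx); apply: open_nbhs_nbhs; split => //.
Qed.

Lemma measure_ball2 (x : R * R) (r : R) : 0 < r ->
  mu2 (ball x r : set RR) = ((r *+ 2) ^+ 2)%:E.
Proof.
move=> r0; rewrite [X in mu2 X](_ : _ = ball x.1 r `*` ball x.2 r); last first.
  by apply/seteqP; split=> y [].
rewrite product_measure1E/=; [|by apply: open_measurable; exact: ball_open..].
by rewrite !lebesgue_measure_ball ?ltW// -EFinM expr2.
Qed.

Lemma bounded_measure_fin S :
  open S -> bounded_set S -> (mu2 (S : set RR) < +oo)%E.
Proof.
move=> oS /bounded_sub_ball[M M0 SM].
apply: (@le_lt_trans _ _ (mu2 (ball (0 : R * R) M : set RR))).
  apply: le_measure => //; rewrite inE; apply: open_measurable2 => //.
  exact: ball_open.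
by rewrite measure_ball2// ltey.
Qed.

End Measure.

(** * Integrals of bounded continuous functions *)

Section BoundedContinuous.
Variable R : realType.
Local Notation RR := (measurableTypeR R * measurableTypeR R)%type.
Local Notation mu1 := (@lebesgue_measure R).
Local Notation mu2 := (mu1 \x mu1)%E.
Implicit Types (S : set (R * R)) (f g : R * R -> R) (x v : R * R).

(** Compactness of the closure in the form used throughout: local constants become one constant,
    monotonicity in [M] allowing the maximum of two. Local validity is required at frontier points
    too, but only for the nearby points of [S]. *)
Lemma locally_uniform S (Q : R -> R * R -> Prop) :
  (forall M N x, M <= N -> Q M x -> Q N x) -> bounded_set S ->
  (forall x, closure S x -> exists M, \forall y \near x, S y -> Q M y) ->
  exists M : R, forall x, S x -> Q M x.
Proof.
move=> Qmono bS loc.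
suff [M QM] : exists M : R, forall x, closure S x -> S x -> Q M x.
  by exists M => x Sx; apply: QM => //; exact: subset_closure.
pose P (A : set (R * R)) := exists M : R, forall x, A x -> S x -> Q M x.
apply: (@compact_induction _ P (closure S)).
- by move=> A B AB [M BM]; exists M => x /AB; exact: BM.
- by exists 0.
- move=> A B [M AM] [N BN]; exists (Num.max M N) => x [Ax|Bx] Sx.
    by apply: Qmono (AM x Ax Sx); rewrite le_max lexx.
  by apply: Qmono (BN x Bx Sx); rewrite le_max lexx orbT.
- exact: bounded_closure_compact.
- by move=> x /loc[M xM]; exists [set y | S y -> Q M y] => //; exists M => y.
Qed.

Lemma cvg_locally_bounded (T : Type) (F : set_system T) (FF : Filter F)
    (f : T -> R) (l : R) : f @ F --> l -> F [set y | `|f y| <= `|l| + 1].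
Proof.
move=> fl.
have : F (f @^-1` ball l 1) by apply: fl; exact: nbhsx_ballx.
apply: filterS => y /=; rewrite /ball/= => h.
have := ler_normD l (f y - l); rewrite addrC subrK => /le_trans; apply.
by rewrite lerD2l distrC ltW.
Qed.

(** The class of integrands: stable under the algebra needed below, and integrable on bounded open
    sets without any continuity at the boundary. *)
Definition bcont S f := (forall x, S x -> {for x, continuous f}) /\
  exists M : R, forall x, S x -> `|f x| <= M.

Lemma bcont_cst S (k : R) : bcont S (fun=> k).
Proof. by split=> [x _|]; [exact: cst_continuous|exists `|k|]. Qed.

Lemma bcontD S f g : bcont S f -> bcont S g -> bcont S (fun x => f x + g x).
Proof.
move=> [cf [M fM]] [cg [N gN]]; split=> [x Sx|].
  by apply: continuousD; [exact: cf|exact: cg].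
exists (M + N) => x Sx; rewrite (le_trans (ler_normD _ _))// lerD ?fM ?gN//.
Qed.

Lemma bcontM S f g : bcont S f -> bcont S g -> bcont S (fun x => f x * g x).
Proof.
move=> [cf [M fM]] [cg [N gN]]; split=> [x Sx|].
  by apply: continuousM; [exact: cf|exact: cg].
by exists (M * N) => x Sx; rewrite normrM ler_pM ?fM ?gN.
Qed.

Lemma bcontN S f : bcont S f -> bcont S (fun x => - f x).
Proof.
move=> [cf [M fM]]; split=> [x Sx|]; first by apply: continuousN; exact: cf.
by exists M => x Sx; rewrite normrN fM.
Qed.

Lemma bcontB S f g : bcont S f -> bcont S g -> bcont S (fun x => f x - g x).
Proof. by move=> nf ng; apply: bcontD => //; exact: bcontN. Qed.

Lemma bcontZ S (k : R) f : bcont S f -> bcont S (fun x => k * f x).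
Proof. by move=> nf; apply: bcontM => //; exact: bcont_cst. Qed.

Lemma bcontX S f n : bcont S f -> bcont S (fun x => f x ^+ n).
Proof.
move=> nf; elim: n => [|n ih]; first exact: bcont_cst.
by under eq_fun do rewrite exprS; exact: bcontM.
Qed.

Lemma bcont_integrable S f : open S -> bounded_set S -> bcont S f ->
  mu2.-integrable (S : set RR) (EFin \o (f : RR -> R)).
Proof.
move=> oS bS [cf [M fM]]; apply: measurable_bounded_integrable.
- exact: open_measurable2.
- exact: bounded_measure_fin.
- exact: measurable_fun_continuous2.
- exists M; split; first exact: num_real.
  by move=> y My x Sx; apply: (le_trans (fM x Sx)); exact: ltW.
Qed.

Definition int2 S f : R := \int[mu2]_(x in (S : set RR)) (f : RR -> R) x.

Section Int.
Variable S : set (R * R).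
Hypotheses (oS : open S) (bS : bounded_set S).

Lemma int2_EFin f : bcont S f ->
  (\int[mu2]_(x in (S : set RR)) ((f : RR -> R) x)%:E)%E = (int2 S f)%:E.
Proof.
move=> nf; rewrite /int2 /Rintegral fineK//.
by apply: integrable_fin_num; [exact: open_measurable2|exact: bcont_integrable].
Qed.

Lemma int2D f g : bcont S f -> bcont S g ->
  int2 S (fun x => f x + g x) = int2 S f + int2 S g.
Proof.
move=> nf ng; apply: RintegralD; first exact: open_measurable2.
all: exact: bcont_integrable.
Qed.

Lemma int2B f g : bcont S f -> bcont S g ->
  int2 S (fun x => f x - g x) = int2 S f - int2 S g.
Proof.
move=> nf ng; apply: RintegralB; first exact: open_measurable2.
all: exact: bcont_integrable.
Qed.

Lemma int2Z k f : bcont S f -> int2 S (fun x => k * f x) = k * int2 S f.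
Proof.
move=> nf; apply: RintegralZl; first exact: open_measurable2.
exact: bcont_integrable.
Qed.

Lemma int2_le f g : bcont S f -> bcont S g -> (forall x, S x -> f x <= g x) ->
  int2 S f <= int2 S g.
Proof.
move=> nf ng fg; apply: le_Rintegral => //; first exact: open_measurable2.
all: exact: bcont_integrable.
Qed.

Lemma int2_ge0 f : (forall x, S x -> 0 <= f x) -> 0 <= int2 S f.
Proof. by move=> f0; apply: Rintegral_ge0. Qed.

Lemma int2_eq f g : (forall x, S x -> f x = g x) -> int2 S f = int2 S g.
Proof. by move=> fg; apply: eq_Rintegral => x; rewrite inE; exact: fg. Qed.

Lemma int2_cst k : int2 S (fun=> k) = k * int2 S (fun=> 1).
Proof.
by rewrite -[in LHS](mulr1 k) (@int2Z k (fun=> 1))//; exact: bcont_cst.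
Qed.

Lemma int2_gt0 f : S !=set0 -> bcont S f -> (forall x, S x -> 0 < f x) ->
  0 < int2 S f.
Proof.
move=> [a Sa] nf f0.
have /nbhs_ballP[r/= r0 aS] : nbhs a [set y | S y /\ f a / 2 < f y].
  apply: filterI; first exact: open_nbhs_nbhs.
  apply: (cvgr_gt _ (nf.1 a Sa)).
  by rewrite ltr_pdivrMr// ltr_pMr ?f0// ltr1n.
have mB : measurable (ball a r : set RR).
  by apply: open_measurable2; exact: ball_open.
have lb : (((f a / 2) * (r *+ 2) ^+ 2)%:E <= (int2 S f)%:E)%E.
  rewrite -int2_EFin//.
  apply: (@le_trans _ _ (\int[mu2]_(x in (ball a r : set RR)) (f x)%:E)%E).
    rewrite EFinM -(@measure_ball2 _ a)// -integral_cst//.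
    apply: ge0_le_integral => //.
    - by move=> x _; rewrite lee_fin divr_ge0// ltW// f0.
    - apply/measurable_EFinP; apply: measurable_fun_continuous2.
        exact: ball_open.
      by move=> x /aS[Sx _]; exact: nf.1.
    - by move=> x /aS[_ h]; rewrite lee_fin ltW.
  apply: ge0_subset_integral => //.
  - exact: open_measurable2.
  - apply/measurable_EFinP; apply: measurable_fun_continuous2 => //.
    by case: nf.
  - by move=> x Sx; rewrite lee_fin ltW// f0.
  - by move=> x /aS[].
rewrite lee_fin in lb; apply: lt_le_trans lb.
by rewrite mulr_gt0// ?divr_gt0 ?f0// exprn_gt0// pmulrn_lgt0.
Qed.

End Int.
End BoundedContinuous.

(** * Compactly supported functions *)

Section CompactSupport.
Variable R : realType.
Local Notation RR := (measurableTypeR R * measurableTypeR R)%type.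
Local Notation mu1 := (@lebesgue_measure R).
Local Notation mu2 := (mu1 \x mu1)%E.

Definition set_coordinate (b : bool) (s : R) (x : R * R) : R * R :=
  if b then (x.1, s) else (s, x.2).

Lemma is_derive_slice (f : R * R -> R) (x : R * R) b s d :
  is_derive (set_coordinate b s x) (axis R b) f d ->
  is_derive s 1 (fun t => f (set_coordinate b t x)) d.
Proof.
move=> /is_derive_line df.
have -> : (fun t => f (set_coordinate b t x)) =
    (fun t => f (t *: axis R b + set_coordinate b s x)) \o (fun t => t - s).
  apply/funext => t /=; congr f; case: b {df} => /=;
  apply/pair_equal_spec; rewrite /= -![_ *: _]/(_ * _); split; ring.
rewrite -[d]mulr1; apply: is_derive1_comp; first by rewrite subrr.
by rewrite -[X in is_derive _ _ _ X]subr0; exact: is_deriveB.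
Qed.

Lemma continuous_slice (f : R * R -> R) (x : R * R) b s :
  {for set_coordinate b s x, continuous f} ->
    {for s, continuous (fun t => f (set_coordinate b t x))}.
Proof.
move=> cf; apply: (@continuous_comp _ _ _ (fun t => set_coordinate b t x) f) => //.
case: b {cf} => /=; rewrite /set_coordinate.
  exact: (cvg_pair (cvg_cst _) cvg_id).
exact: (cvg_pair cvg_id (cvg_cst _)).
Qed.

Lemma FTC2_is_derive (w dw : R -> R) (a b : R) : a < b ->
  (forall t, t \in `[a, b] -> is_derive t 1 w (dw t)) ->
  (forall t, t \in `[a, b] -> {for t, continuous dw}) ->
  (\int[mu1]_(t in `[a, b]) (dw t)%:E = (w b - w a)%:E)%E.
Proof.
move=> ab dwP cdw.
have cw t : t \in `[a, b] -> {for t, continuous w}.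
  move=> tab; apply: differentiable_continuous; apply/derivable1_diffP.
  by have [] := dwP t tab.
have sub t : t \in `]a, b[ -> t \in `[a, b] by exact: subset_itv_oo_cc.
rewrite EFinB; apply: continuous_FTC2 => //.
- apply: continuous_in_subspaceT => t; rewrite inE/= => tab; exact: cdw.
- split=> [t /sub tab||].
  + by have [] := dwP t tab.
  + by apply: cvg_at_right_filter; apply: cw; rewrite in_itv/= lexx ltW.
  + by apply: cvg_at_left_filter; apply: cw; rewrite in_itv/= lexx ltW.
- by move=> t /sub tab; rewrite derive1E; have [_ ->] := dwP t tab.
Qed.

Lemma integral_derive_compact (w dw : R -> R) (M : R) : 0 < M ->
  (forall t : R, is_derive t 1 w (dw t)) -> continuous dw ->
  (forall t, M <= `|t| -> w t = 0) -> (forall t, M <= `|t| -> dw t = 0) ->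
  (\int[mu1]_t (dw t)%:E = 0)%E.
Proof.
move=> M0 dwP cdw w0 dw0.
transitivity (\int[mu1]_(t in `[(- M)%R, M]) (dw t)%:E)%E; last first.
  rewrite (@FTC2_is_derive w).
  - by rewrite !w0 ?subrr// ?normrN ler_norm.
  - by rewrite gtrN.
  - by move=> t _; exact: cdw.
rewrite [RHS]integral_mkcond/=; apply: eq_integral => t _.
rewrite patchE; case: ifPn => //; rewrite notin_setE/= in_itv/= => /negP.
by rewrite -ler_norml -ltNge => /ltW/dw0 ->.
Qed.

(** Fubini, integrating first in the direction [b]: on each line the integrand is the derivative of
    a function that vanishes at both ends. All later integrations by parts rest on this one. *)
Lemma integral_partial_compact b (W : R * R -> R) G (M : R) : 0 < M ->
  C1grad setT W G ->
  (forall x, ~ ball (0 : R * R) M x -> W x = 0 /\ G b x = 0) ->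
  (\int[mu2]_x ((G b : RR -> R) x)%:E = 0)%E.
Proof.
move=> M0 CW W0.
have dW x : is_derive x (axis R b) W (G b x) by have [_ /(_ b)[]] := CW x I.
have cG x : {for x, continuous (G b)} by have [_ /(_ b)[]] := CW x I.
have oB : open (ball (0 : R * R) M) by exact: ball_open.
have bB := @bounded_ball2 R 0 M.
have intG : mu2.-integrable setT (EFin \o (G b : RR -> R)).
  have -> : EFin \o (G b : RR -> R) =
      (EFin \o (G b : RR -> R)) \_ (ball (0 : R * R) M : set RR).
    apply/funext => x; rewrite patchE /=; case: ifPn => //.
    by rewrite notin_setE => /W0[_ ->].
  apply/(integrable_restrict _ _ _ _).1 => //.
    exact: open_measurable2.
  rewrite setTI; apply: bcont_integrable => //; split=> // .
  apply: locally_uniform => //.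
    by move=> L N x LN h; exact: le_trans h LN.
  move=> x _; exists (`|G b x| + 1).
  apply: filterS (cvg_locally_bounded _ (cG x)).
  by move=> y.
have out b' (s : R) (x : R * R) : M <= `|s| ->
  ~ ball (0 : R * R) M (set_coordinate b' s x).
  by move=> Ms /in_ball[]; case: b'; rewrite /= !sub0r !normrN !ltNge Ms.
have slice x : (\int[mu1]_s (G b (set_coordinate b s x))%:E = 0)%E.
  apply: (@integral_derive_compact (fun s => W (set_coordinate b s x)) _ M) => //.
  - by move=> s; apply: is_derive_slice.
  - by move=> s; apply: continuous_slice.
  - by move=> t Mt; have [->] := W0 _ (out b t x Mt).
  - by move=> t Mt; have [_ ->] := W0 _ (out b t x Mt).
case: b {dW cG W0} intG slice => intG slice.
- rewrite -integral12_prod_meas1// /fubini_F/=.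
  by rewrite integral0_eq// => s _; exact: (slice (s, 0)).
- rewrite -integral21_prod_meas1// /fubini_G/=.
  by rewrite integral0_eq// => s _; exact: (slice (0, s)).
Qed.

End CompactSupport.

(** * A cutoff function *)

Section Cutoff.
Variable R : realType.
Implicit Types s : R.

(** The exponent is shifted so that every [ppow n] is continuous and every [ppow n.+1] is C1. *)
Definition ppow (n : nat) s : R := (Num.max s 0) ^+ n.+1.

Lemma ppow_le0 n s : s <= 0 -> ppow n s = 0.
Proof. by move=> s0; rewrite /ppow max_r// expr0n. Qed.

Lemma ppow_ge0E n s : 0 <= s -> ppow n s = s ^+ n.+1.
Proof. by move=> s0; rewrite /ppow max_l. Qed.

Lemma ppow_ge0 n s : 0 <= ppow n s.
Proof. by rewrite /ppow exprn_ge0// le_max lexx orbT. Qed.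

Lemma ppow_gt0 n s : (0 < ppow n s) = (0 < s).
Proof.
have [s0|s0] := leP s 0; first by rewrite ppow_le0 ?ltxx.
by rewrite ppow_ge0E ?ltW// exprn_gt0.
Qed.

Lemma ppowS n s : ppow n.+1 s = s * ppow n s.
Proof.
have [s0|s0] := leP s 0; first by rewrite !ppow_le0 ?mulr0.
by rewrite !ppow_ge0E ?ltW// -exprS.
Qed.

Lemma continuous_ppow n : continuous (ppow n).
Proof.
move=> s; apply: (@continuous_comp _ _ _ (fun t : R => Num.max t 0) (fun t =>
  t ^+ n.+1)).
  apply: (@continuous_max _ _ id (fun=> 0)); [exact: cvg_id|exact: cst_continuous].
exact: exprn_continuous.
Qed.

Lemma is_derive_ppow n s : is_derive s 1 (ppow n.+1) (n.+2%:R * ppow n s).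
Proof.
have one0 : (1 : R) != 0 by exact: oner_neq0.
have [s0|s0|->] := ltgtP s 0.
- rewrite ppow_le0 ?mulr0 ?ltW//.
  apply: (@near_eq_is_derive _ _ _ (fun=> 0)) => //.
  by near=> t; rewrite ppow_le0// ltW//; near: t; exact: lt_nbhsl.
- rewrite ppow_ge0E ?ltW//.
  apply: (@near_eq_is_derive _ _ _ (fun t : R => t ^+ n.+2)) => //.
    by near=> t; rewrite ppow_ge0E// ltW//; near: t; exact: lt_nbhsr.
  split; first exact: exprn_derivable.
  by rewrite exp_derive [_ *: 1]mulr1.
- rewrite ppow_le0// mulr0.
  suff h0 : h^-1 *: ((ppow n.+1 \o shift 0) (h *: (1 : R)) - ppow n.+1 0)
      @[h --> (0 : R)^'] --> (0 : R).
    split; first by apply/cvg_ex; exists 0.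
    exact: cvg_lim h0.
  apply: (@cvg_trans _ (ppow n h @[h --> (0 : R)^'])).
    apply: near_eq_cvg; near=> h.
    have h0 : h != 0 by near: h; exact: nbhs_dnbhs_neq.
    rewrite /= addr0 [h *: 1]mulr1 (@ppow_le0 n.+1 0)// subr0 ppowS.
    by rewrite [_ *: _]mulrA mulVf// mul1r.
  have c0 := @continuous_ppow n 0; rewrite /continuous_at ppow_le0// in c0.
  by apply: cvg_within_filter.
Unshelve. all: by end_near. Qed.

(* The C1 quadratic spline rising from 0 to 1 on [[0, 1]]. *)
Definition cutoff s : R :=
  2 * ppow 1 s - 4 * ppow 1 (s - 2^-1) + 2 * ppow 1 (s - 1).
Definition dcutoff s : R :=
  4 * ppow 0 s - 8 * ppow 0 (s - 2^-1) + 4 * ppow 0 (s - 1).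

Lemma is_derive_cutoff s : is_derive s 1 cutoff (dcutoff s).
Proof.
have d (a : R) : is_derive s 1 (fun t => ppow 1 (t - a)) (2 * ppow 0 (s - a)).
  rewrite -[2 * _]mulr1; apply: (@is_derive1_comp _ (ppow 1) (fun t => t - a)).
    exact: is_derive_ppow.
  by rewrite -[X in is_derive _ _ _ X]subr0; exact: is_deriveB.
have d0 := d 0; have d1 := d 2^-1; have d2 := d 1.
have -> : cutoff = (fun t => 2 * ppow 1 (t - 0) - 4 * ppow 1 (t - 2^-1)
    + 2 * ppow 1 (t - 1)) by apply/funext => t; rewrite subr0.
apply: is_derive_eq.
rewrite /dcutoff subr0 -![_ *: _]/(_ * _); ring.
Qed.

Lemma continuous_dcutoff : continuous dcutoff.
Proof.
move=> s.
have c (a k : R) : {for s, continuous (fun t => k * ppow 0 (t - a))}.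
  apply: cvgM; first exact: cvg_cst.
  apply: (@continuous_comp _ _ _ (fun t => t - a) (ppow 0)).
    by apply: cvgB; [exact: cvg_id|exact: cvg_cst].
  exact: continuous_ppow.
have c0 := c 0 4; rewrite /prop_for /continuous_at in c0.
have -> : dcutoff = (fun t => 4 * ppow 0 (t - 0) - 8 * ppow 0 (t - 2^-1)
    + 4 * ppow 0 (t - 1)) by apply/funext => t; rewrite subr0.
by apply: cvgD; [apply: cvgB|]; exact: c.
Qed.

Lemma ppowE n s : ppow n s = if 0 <= s then s ^+ n.+1 else 0.
Proof. by case: leP => h; [rewrite ppow_ge0E|rewrite ppow_le0// ltW]. Qed.

Lemma cutoff_le0 s : s <= 0 -> cutoff s = 0.
Proof. by move=> s0; rewrite /cutoff !ppow_le0 ?mulr0 ?subr0 ?addr0//; lra. Qed.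

Lemma dcutoff_le0 s : s <= 0 -> dcutoff s = 0.
Proof. by move=> s0; rewrite /dcutoff !ppow_le0 ?mulr0 ?subr0 ?addr0//; lra. Qed.

Lemma cutoff_ge1 s : 1 <= s -> cutoff s = 1.
Proof. by move=> s0; rewrite /cutoff !ppow_ge0E; [field|lra..]. Qed.

Lemma dcutoff_ge1 s : 1 <= s -> dcutoff s = 0.
Proof. by move=> s0; rewrite /dcutoff !ppow_ge0E; [field|lra..]. Qed.

Lemma cutoff_norm s : `|cutoff s| <= 1.
Proof.
have [s0|s0] := leP s 0; first by rewrite cutoff_le0// normr0.
have [s1|s1] := leP 1 s; first by rewrite cutoff_ge1// normr1.
rewrite /cutoff (@ppow_le0 _ (s - 1)); last by lra.
rewrite (@ppow_ge0E _ s); last by lra.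
rewrite ler_norml ppowE; case: ifPn => h; apply/andP; split; nra.
Qed.

Lemma dcutoff_ge0 s : 0 <= dcutoff s.
Proof.
have [s0|s0] := leP s 0; first by rewrite dcutoff_le0.
have [s1|s1] := leP 1 s; first by rewrite dcutoff_ge1.
rewrite /dcutoff (@ppow_le0 _ (s - 1)); last by lra.
rewrite (@ppow_ge0E _ s); last by lra.
by rewrite ppowE; case: ifPn => h; nra.
Qed.

End Cutoff.

(** * The divergence inequality *)

Section Divergence.
Variable R : realType.
Local Notation RR := (measurableTypeR R * measurableTypeR R)%type.
Local Notation mu1 := (@lebesgue_measure R).
Local Notation mu2 := (mu1 \x mu1)%E.
Implicit Types (f g : R * R -> R) (x y : R * R).

Lemma bcont_frontier (S : set (R * R)) f : open S -> bounded_set S ->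
  (forall x, S x -> {for x, continuous f}) ->
  (forall x, frontier S x -> exists M, \forall y \near x, S y -> `|f y| <= M) ->
  bcont S f.
Proof.
move=> oS bS cf bf; split=> //.
apply: locally_uniform => // [M N x MN h|x cSx]; first exact: le_trans h MN.
have [Sx|nSx] := pselect (S x); last first.
  by apply: bf; split=> // /interior_subset.
exists (`|f x| + 1).
by apply: filterS (cvg_locally_bounded _ (cf x Sx)) => y.
Qed.

Lemma bcont_limit (S : set (R * R)) f (l : R * R -> R) : open S -> bounded_set S ->
  (forall x, S x -> {for x, continuous f}) ->
  (forall x, closure S x -> f @ within S (nbhs x) --> l x) -> bcont S f.
Proof.
move=> oS bS cf fl; apply: bcont_frontier => // x [cSx _].
by exists (`|l x| + 1); exact: (cvg_locally_bounded _ (fl x cSx)).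
Qed.

Lemma bcont_continuous (S : set (R * R)) f : open S -> bounded_set S ->
  (forall x, {for x, continuous f}) -> bcont S f.
Proof.
move=> oS bS cf; apply: bcont_frontier => // x _.
exists (`|f x| + 1).
by apply: filterS (cvg_locally_bounded _ (cf x)) => y.
Qed.

Definition div (G : bool -> bool -> R * R -> R) x :=
  G false false x + G true true x.
Definition dot (Y Z : bool -> R * R -> R) x :=
  Y false x * Z false x + Y true x * Z true x.

Variables (S : set (R * R)) (h : R * R -> R) (H : bool -> R * R -> R)
  (HH : bool -> bool -> R * R -> R).
Hypotheses (oS : open S) (bS : bounded_set S) (Sh : forall x, S x <-> 0 < h x).
Hypotheses (Ch : C1grad setT h H) (CH : forall b, C1grad setT (H b) (HH b)).
Hypothesis H0 : forall x, frontier S x -> 0 < dot H H x.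

Let ch x : {for x, continuous h}. Proof. by have [] := Ch (x := x) I. Qed.
Let cH b x : {for x, continuous (H b)}. Proof. by have [] := CH b (x := x) I. Qed.
Let cHH b b' x : {for x, continuous (HH b b')}.
Proof. by have [_ /(_ b')[]] := CH b (x := x) I. Qed.

Lemma bcont_h : bcont S h. Proof. exact: bcont_continuous. Qed.
Lemma bcont_H b : bcont S (H b). Proof. exact: bcont_continuous. Qed.
Lemma bcont_HH b b' : bcont S (HH b b'). Proof. exact: bcont_continuous. Qed.

Lemma bcont_dot Y Z : (forall b, bcont S (Y b)) -> (forall b, bcont S (Z b)) ->
  bcont S (dot Y Z).
Proof. by move=> nY nZ; apply: bcontD; exact: bcontM. Qed.

(** Compactness turns neighbourhoods of frontier points into a strip [h < t]: near a frontier point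
    [Q] holds, near any other point of the closure [1 / h] is bounded, and [locally_uniform] applies
    to the disjunction. *)
Lemma near_frontier (Q : R * R -> Prop) :
  (forall x, frontier S x -> \forall y \near x, S y -> Q y) ->
  exists2 t : R, 0 < t & forall x, S x -> h x < t -> Q x.
Proof.
move=> Qf.
have [||M QM] := @locally_uniform R S (fun M x => Q x \/ 1 <= h x * M /\ S x) _ bS.
- move=> M N x MN [|[hM Sx]]; [by left|right; split=> //].
  by rewrite (le_trans hM)// ler_pM2l//; exact/Sh.
- move=> x cSx; have [Sx|nSx] := pselect (S x); last first.
    exists 0; have /Qf : frontier S x by split=> // /interior_subset.
    by apply: filterS => y Qy /Qy; left.
  have hx : 0 < h x by exact/Sh.
  exists (2 / h x).
  have : \forall y \near x, h x / 2 < h y.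
    apply: (cvgr_gt _ (@ch x)).
    by rewrite ltr_pdivrMr// ltr_pMr// ltr1n.
  apply: filterS => y hy Sy; right; split=> //.
  by rewrite mulrA ler_pdivlMr// mul1r; lra.
- exists (`|M| + 1)^-1; first by rewrite invr_gt0 ltr_pwDr.
  move=> x Sx; rewrite -[_^-1]mul1r ltr_pdivlMr ?ltr_pwDr// => hM.
  have [//|[]] := QM x Sx.
  have hx : 0 < h x by exact/Sh.
  have : h x * M <= h x * (`|M| + 1).
    by rewrite ler_pM2l// (le_trans (ler_norm M))// lerDl.
  lra.
Qed.

(** [layer e] is the factor of [H] in the gradient of [inner e]. The shift by 1 makes [inner e]
    vanish on all of [h <= e], not just outside [S], so that its product with a field known only on
    [S] extends by zero. *)
Definition layer (e : R) x := e^-1 * dcutoff (h x / e - 1).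
Definition inner (e : R) x := cutoff (h x / e - 1).

Lemma C1grad_inner e : C1grad setT (inner e) (fun b x => layer e x * H b x).
Proof.
have Cl : C1grad setT (fun x => h x / e - 1) (fun b x => e^-1 * H b x).
  apply: (C1grad_eq openT _ _ (C1gradB (C1gradZ e^-1 Ch) (@C1grad_cst _ _ 1))).
    by move=> x _; rewrite mulrC.
  by move=> b x _; rewrite subr0.
have Cc : forall x, setT x -> is_derive (h x / e - 1) 1 (@cutoff R)
    (dcutoff (h x / e - 1)) /\ {for h x / e - 1, continuous (@dcutoff R)}.
  by move=> x _; split; [exact: is_derive_cutoff|exact: continuous_dcutoff].
apply: (C1grad_eq openT _ _ (C1grad_comp Cc Cl)) => // b x _.
by rewrite /layer mulrA [dcutoff _ * _]mulrC.
Qed.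

Lemma bcont_inner e : bcont S (inner e).
Proof.
by apply: bcont_continuous => // x; have [] := @C1grad_inner e x I.
Qed.

Lemma bcont_layer e : bcont S (layer e).
Proof.
apply: bcont_continuous => // x; apply: cvgM; first exact: cvg_cst.
apply: (@continuous_comp _ _ _ (fun y => h y / e - 1) (@dcutoff R)).
  apply: cvgB; last exact: cvg_cst.
  by apply: cvgM; [exact: ch|exact: cvg_cst].
exact: continuous_dcutoff.
Qed.

Lemma layer_ge0 e x : 0 < e -> 0 <= layer e x.
Proof. by move=> e0; apply: mulr_ge0; [rewrite invr_ge0 ltW|exact: dcutoff_ge0].
  Qed.

Lemma inner_small e x : 0 < e -> h x <= e -> inner e x = 0.
Proof. by move=> e0 he; rewrite /inner cutoff_le0// subr_le0 ler_pdivrMr// mul1r.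
  Qed.

Lemma layer_small e x : 0 < e -> h x <= e -> layer e x = 0.
Proof.
by move=> e0 he; rewrite /layer dcutoff_le0 ?mulr0// subr_le0 ler_pdivrMr// mul1r.
Qed.

Lemma inner_large e x : 0 < e -> 2 * e <= h x -> inner e x = 1.
Proof.
by move=> e0 he; rewrite /inner cutoff_ge1// lerBrDr ler_pdivlMr.
Qed.

Lemma layer_large e x : 0 < e -> 2 * e <= h x -> layer e x = 0.
Proof.
by move=> e0 he; rewrite /layer dcutoff_ge1 ?mulr0// lerBrDr ler_pdivlMr.
Qed.

(** The divergence of [inner e * Y], extended by zero, integrates to zero over the plane. *)
Lemma cutoff_identity e (Y : bool -> R * R -> R) YG : 0 < e ->
  (forall b, C1grad S (Y b) (YG b)) -> (forall b, bcont S (Y b)) ->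
  bcont S (div YG) ->
  int2 S (fun x => inner e x * div YG x)
    = - int2 S (fun x => layer e x * dot H Y x).
Proof.
move=> e0 CY nY nD.
pose G b b' x := inner e x * YG b b' x + layer e x * H b' x * Y b x.
(* The open sets [0 < h] and [h < e] cover the plane: the product rule holds on the first, the
   product is zero on the second. *)
have CG b : C1grad setT (fun x => inner e x * Y b x) (G b).
  move=> x _; have [hx|hx] := ltP 0 (h x).
    have C1 : C1grad S (inner e) (fun b x => layer e x * H b x).
      by apply: C1grad_sub (@C1grad_inner e).
    by have := C1gradM C1 (CY b) (x := x); apply; apply/Sh.
  pose A := [set y | h y < e].
  have oA : open A.
    rewrite openE => y /= hy; apply: (cvgr_lt _ (@ch y)); exact: hy.
  apply: (C1grad_eq oA _ _ (@C1grad_cst R A 0)); last by rewrite /A/=; lra.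
    by move=> y /ltW hy; rewrite inner_small// mul0r.
  by move=> b' y /ltW hy; rewrite /G inner_small// layer_small// !mul0r addr0.
have nG b b' : bcont S (G b b').
  apply: bcont_continuous => // x.
  by have [_ /(_ b')[]] := CG b x I.
have [M M0 SM] := bounded_sub_ball bS.
have nS x : ~ S x -> inner e x = 0 /\ layer e x = 0.
  move=> /Sh/negP; rewrite -leNgt => hx.
  by rewrite inner_small ?layer_small//; exact: le_trans hx (ltW e0).
have G0 b : int2 S (G b b) = 0.
  have := integral_partial_compact (b := b) M0 (CG b).
  have -> : (\int[mu2]_x ((G b b : RR -> R) x)%:E)%E = (int2 S (G b b))%:E.
    rewrite -int2_EFin// [RHS]integral_mkcond; apply: eq_integral => x _.
    rewrite patchE; case: ifPn => //; rewrite notin_setE => /nS[i0 l0].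
    by rewrite /G i0 l0 !mul0r addr0.
  move=> h0; apply: EFin_inj; apply: h0 => x nx.
  have /nS[i0 l0] : ~ S x by move=> /SM.
  by rewrite /G i0 l0 !mul0r addr0.
have : int2 S (fun x => G false false x + G true true x) = 0.
  by rewrite int2D// !G0 addr0.
rewrite (@int2_eq _ _ _ (fun x => inner e x * div YG x + layer e x * dot H Y x)).
  move=> hs; apply/eqP; rewrite -addr_eq0 -int2D ?hs//.
    by apply: bcontM => //; exact: bcont_inner.
  by apply: bcontM; [exact: bcont_layer|exact: bcont_dot bcont_H nY].
by move=> x _; rewrite /G /div /dot; ring.
Qed.

Lemma frontier_h0 x : frontier S x -> h x = 0.
Proof.
move=> [cSx niS]; apply/eqP; rewrite eq_le; apply/andP; split.
  rewrite leNgt; apply/negP => /Sh Sx; apply: niS.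
  exact: open_nbhs_nbhs.
rewrite leNgt; apply/negP => hx.
have /cSx[y [/Sh hy /= hy']] : \forall y \near x, h y < 0.
  exact: (cvgr_lt _ (@ch x)).
by move: (lt_trans hy hy'); rewrite ltxx.
Qed.

(** The sum is positive at every point of the closure, by [h > 0] inside and [H0] on the frontier.
    Compactness is applied to its reciprocal, hence the form [1 <= _ * M]. *)
Lemma nondegenerate :
  exists2 c : R, 0 < c & forall x, S x -> c <= dot H H x + h x.
Proof.
have [||M QM] :=
  @locally_uniform R S (fun M x => 1 <= (dot H H x + h x) * M /\ S x) _ bS.
- move=> M N x MN [hM Sx]; split=> //; rewrite (le_trans hM)// ler_wpM2l//.
  by rewrite addr_ge0// ?addr_ge0 -?expr2 ?sqr_ge0//; exact/ltW/Sh.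
- move=> x cSx.
  have s0 : 0 < dot H H x + h x.
    have [Sx|nSx] := pselect (S x).
      by rewrite ltr_wpDl// ?addr_ge0 -?expr2 ?sqr_ge0//; exact/Sh.
    have fx : frontier S x by split=> // /interior_subset.
    by rewrite frontier_h0// addr0 H0.
  exists (2 / (dot H H x + h x)).
  have : \forall y \near x, (dot H H x + h x) / 2 < dot H H y + h y.
    apply: (@cvgr_gt _ _ (nbhs x) _ (fun y => dot H H y + h y) (dot H H x + h x)).
      apply: cvgD; last exact: ch.
      by apply: cvgD; apply: cvgM; exact: cH.
    by rewrite ltr_pdivrMr// ltr_pMr// ltr1n.
  apply: filterS => y hy Sy; split=> //.
  by rewrite mulrA ler_pdivlMr// mul1r; lra.
- exists (`|M| + 1)^-1; first by rewrite invr_gt0 ltr_pwDr.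
  move=> x Sx; have [hM _] := QM x Sx.
  rewrite -[_^-1]mul1r ler_pdivrMr ?ltr_pwDr//; apply: (le_trans hM).
  apply: ler_wpM2l; last by rewrite (le_trans (ler_norm M))// lerDl.
  by rewrite addr_ge0// ?addr_ge0 -?expr2 ?sqr_ge0//; exact/ltW/Sh.
Qed.

Lemma layer_bounded : exists2 e0 : R, 0 < e0 &
  exists K : R, forall e, 0 < e -> e < e0 -> int2 S (layer e) <= K.
Proof.
have nLH : bcont S (div HH) by apply: bcontD; exact: bcont_HH.
have [c c0 hc] := nondegenerate.
have [M HM] := nLH.2.
(* For [e < c / 4] the layer lies in [h < 2 * e < c / 2], where [dot H H] is at least [c / 2]. *)
exists (c / 4); first by rewrite divr_gt0.
exists ((c / 2)^-1 * int2 S (fun x => M)) => e e0 et.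
rewrite mulrC ler_pdivlMr ?divr_gt0// mulrC -int2Z//; last exact: bcont_layer.
have nl : bcont S (fun x => layer e x * dot H H x).
  by apply: bcontM; [exact: bcont_layer|apply: bcont_dot; exact: bcont_H].
have ni : bcont S (fun x => inner e x * div HH x).
  by apply: bcontM => //; exact: bcont_inner.
apply: (@le_trans _ _ (int2 S (fun x => layer e x * dot H H x))).
  apply: int2_le => //; first by apply: bcontZ; exact: bcont_layer.
  move=> x Sx; have [ht|ht] := leP (2 * e) (h x).
    by rewrite layer_large// !mulr0 mul0r.
  rewrite mulrC ler_wpM2l ?layer_ge0//.
  by have := hc x Sx; lra.
have CHS b : C1grad S (H b) (HH b) by apply: C1grad_sub (CH b).
rewrite -[leLHS]opprK -(cutoff_identity e0 CHS)//; last by move=> b; exact: bcont_H.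
rewrite -mulN1r -int2Z//; apply: int2_le => //.
- exact: bcontZ.
- exact: bcont_cst.
- move=> x Sx; rewrite mulN1r (le_trans (ler_norm _))// normrN normrM.
  by rewrite -[leRHS]mul1r ler_pM ?cutoff_norm ?HM.
Qed.

Lemma int2_inner_cvg g : bcont S g ->
  (int2 S (fun x => inner n.+1%:R^-1 x * g x))%:E @[n --> \oo] --> (int2 S g)%:E.
Proof.
move=> ng; have [N gN] := ng.2.
have nin e : bcont S (fun x => inner e x * g x).
  by apply: bcontM => //; exact: bcont_inner.
under eq_fun do rewrite -int2_EFin//.
rewrite -int2_EFin//.
apply: (@dominated_cvg _ _ _ mu2 S _ _ _ (fun=> N%:E)) => //.
- exact: open_measurable2.
- move=> n; apply/measurable_EFinP; apply: measurable_fun_continuous2 => //.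
  by have [] := nin n.+1%:R^-1.
- move=> x Sx; apply: cvg_near_cst; have /Sh hx := Sx.
  near=> n; rewrite inner_large ?mul1r ?invr_gt0//.
  rewrite ler_pdivrMr// mulrC -ler_pdivrMr// (le_trans _ (_ : n%:R <= _))//.
    by near: n; exact: nbhs_infty_ger.
  by rewrite ler_nat.
- exact: bcont_integrable (bcont_cst S N).
- move=> n x Sx; rewrite abse_EFin lee_fin normrM -[leRHS]mul1r.
  by rewrite ler_pM ?gN//; exact: cutoff_norm.
Unshelve. all: by end_near. Qed.

(* [dot H Y] is [|grad h|] times the inward normal component of [Y]. The mass of
   [layer e] stays bounded as [e] tends to 0, as seen by taking [Y = grad h]. *)
Lemma divergence_le0 (Y : bool -> R * R -> R) YG :
  (forall b, C1grad S (Y b) (YG b)) -> (forall b, bcont S (Y b)) ->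
  bcont S (div YG) ->
  (forall x (e : R), frontier S x -> 0 < e ->
    \forall y \near x, S y -> - e <= dot H Y y) ->
  int2 S (div YG) <= 0.
Proof.
move=> CY nY nD fY.
have [e0 e00 [K0 K0P]] := layer_bounded.
pose K : R := `|K0| + 1.
have K1 : 0 < K by rewrite ltr_pwDr.
have KP e : 0 < e -> e < e0 -> int2 S (layer e) <= K.
  by move=> ? ?; rewrite (le_trans (K0P _ _ _))// (le_trans (ler_norm _))// lerDl.
apply/ler_addgt0Pl => d d0; rewrite addr0.
(* With slack [d / K] in the boundary hypothesis, a layer of mass at most [K] contributes at most
   [d]. *)
have dK : 0 < d / K by rewrite divr_gt0.
have [t t0 tP] := near_frontier (fun x fx => fY x _ fx dK).
have := int2_inner_cvg nD; rewrite -lee_fin => cv.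
rewrite -(cvg_lim _ cv)//; apply: lime_le; first by apply/cvg_ex;
  exists (int2 S (div YG))%:E.
near=> n; rewrite lee_fin.
have ee : n.+1%:R^-1 < e0.
  by near: n; exact: (near_infty_natSinv_lt (PosNum e00)).
(* The layer is contained in [h < 2 * e], hence in the strip [h < t]. *)
have et : n.+1%:R^-1 < t / 2.
  by near: n; exact: (near_infty_natSinv_lt (PosNum (divr_gt0 t0 (ltr0Sn _ 1)))).
have ep : 0 < n.+1%:R^-1 :> R by rewrite invr_gt0.
move: (n.+1%:R^-1 : R) ee et ep => e ee et ep.
rewrite (cutoff_identity ep CY)// -mulN1r -int2Z//; last first.
  by apply: bcontM; [exact: bcont_layer|exact: bcont_dot bcont_H nY].
apply: (@le_trans _ _ (int2 S (fun x => d / K * layer e x))).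
  apply: int2_le => //.
  - apply: bcontZ; apply: bcontM; [exact: bcont_layer|exact: bcont_dot bcont_H nY].
  - by apply: bcontZ; exact: bcont_layer.
  move=> x Sx; have [ht|ht] := leP (2 * e) (h x).
    by rewrite layer_large// !(mul0r,mulr0).
  rewrite mulN1r -mulrN mulrC ler_wpM2r ?layer_ge0//.
  by rewrite lerNl tP//; lra.
rewrite int2Z//; last exact: bcont_layer.
by rewrite mulrAC ler_pdivrMr// ler_pM2l// KP.
Unshelve. all: by end_near. Qed.

End Divergence.

(** * The Poincare inequality *)

Section BoxPoincare.
Variable R : realType.
Local Notation RR := (measurableTypeR R * measurableTypeR R)%type.
Local Notation mu1 := (@lebesgue_measure R).
Local Notation mu2 := (mu1 \x mu1)%E.
Local Open Scope ereal_scope.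

(** Cauchy-Schwarz for the integral of [dw] between [t] and [s], obtained by integrating
    [0 <= (dw - d / L)^2] with [d] the increment and [L] the length. Nothing is assumed at the
    endpoints [p] and [q], so the right-hand side may be infinite. *)
Lemma sqr_increment_le (w dw : R -> R) (p q : R) :
  (forall t, t \in `]p, q[ -> is_derive t 1%R w (dw t)) ->
  (forall t, t \in `]p, q[ -> {for t, continuous dw}) ->
  forall s t, s \in `]p, q[ -> t \in `]p, q[ ->
  ((w s - w t) ^+ 2)%:E <= (q - p)%:E * \int[mu1]_(u in `]p, q[) ((dw u) ^+ 2)%:E.
Proof.
move=> dwP cdw s t.
wlog ts : s t / (t <= s)%R.
  move=> hw sI tI; have [ts|/ltW st] := leP t s; first exact: hw.
  by rewrite -sqrrN opprB; exact: hw.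
move=> sI tI.
have pq : (0 <= q - p)%R.
  by rewrite subr_ge0 ltW//; move: sI; rewrite in_itv/= => /andP[]; exact: lt_trans.
have ge0 : 0 <= (q - p)%:E * \int[mu1]_(u in `]p, q[) ((dw u) ^+ 2)%:E.
  by rewrite mule_ge0 ?lee_fin// integral_ge0// => x _; rewrite lee_fin sqr_ge0.
move: ts; rewrite le_eqVlt => /predU1P[->|ts]; first by rewrite subrr expr0n.
have sub u : u \in `[t, s] -> u \in `]p, q[.
  move: sI tI; rewrite !in_itv/= => /andP[? ?] /andP[? ?] /andP[? ?].
  by apply/andP; split; lra.
have subs : `[t, s]%classic `<=` `]p, q[%classic by move=> u /sub.
pose L := (s - t)%R; have L0 : (0 < L)%R by rewrite subr_gt0.
pose d := (w s - w t)%R.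
have int_cc (g : R -> R) : (forall u, u \in `[t, s] -> {for u, continuous g}) ->
    mu1.-integrable `[t, s] (EFin \o g).
  move=> cg; apply: continuous_compact_integrable; first exact: segment_compact.
  by apply: continuous_in_subspaceT => u; rewrite inE/= => /cg.
have cw u : u \in `[t, s] -> {for u, continuous dw} by move=> /sub; exact: cdw.
have czw (k : R) u : u \in `[t, s] -> {for u, continuous (fun u => k * dw u)%R}.
  by move=> /cw cu; apply: cvgM; [exact: cvg_cst|exact: cu].
have mts : mu1 `[t, s]%classic = L%:E by rewrite lebesgue_measure_itv/= lte_fin ts.
have ftc : \int[mu1]_(u in `[t, s]) (dw u)%:E = d%:E.
  exact: (FTC2_is_derive ts (fun u hu => dwP u (sub u hu))
    (fun u hu => cdw u (sub u hu))).
have key : (d ^+ 2 / L)%:E <= \int[mu1]_(u in `[t, s]) ((dw u) ^+ 2)%:E.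
  have -> : (d ^+ 2 / L)%:E =
      \int[mu1]_(u in `[t, s]) (2 * (d / L) * dw u - (d / L) ^+ 2)%:E.
    under eq_integral do rewrite EFinB.
    rewrite integralB_EFin//; [|exact: int_cc (czw _)|]; last first.
      by apply: int_cc => u _; exact: cst_continuous.
    under eq_integral do rewrite EFinM.
    rewrite integralZl//; last exact: int_cc cw.
    rewrite ftc integral_cst// [X in _ - _ * X]mts.
    rewrite -!EFinM -EFinB; congr EFin; rewrite -/L; field.
    by rewrite gt_eqF.
  apply: le_integral => //.
  - by apply: int_cc => u /(czw (2 * (d / L))%R) cu; apply: cvgB;
    [exact: cu|exact: cvg_cst].
  - by apply: int_cc => u /cw cu; apply: cvgM; exact: cu.
  move=> u _; rewrite lee_fin -subr_ge0.
  by rewrite (_ : (_ - _)%R = ((dw u - d / L) ^+ 2)%R) ?sqr_ge0//; ring.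
apply: (@le_trans _ _ (L%:E * (d ^+ 2 / L)%:E)).
  by rewrite -EFinM lee_fin mulrC divfK// gt_eqF.
apply: lee_pmul => //.
- by rewrite lee_fin ltW.
- by rewrite lee_fin divr_ge0 ?sqr_ge0// ltW.
- rewrite lee_fin /L; move: sI tI; rewrite !in_itv/= => /andP[? ?] /andP[? ?]; lra.
- apply: (le_trans key); apply: ge0_subset_integral => //.
  apply/measurable_EFinP; apply: open_continuous_measurable_fun.
    exact: interval_open.
  by move=> u; rewrite inE/= => uI; apply: cvgM; exact: cdw.
  by move=> u _; rewrite lee_fin sqr_ge0.
Qed.

Lemma ball_itv (a : R * R) (r : R) (z : R * R) :
  ball a r z <-> forall b, coordinate b z \in `](coordinate b a - r)%R,
    (coordinate b a + r)%R[.
Proof.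
rewrite in_ball; split=> [[h1 h2] b|h]; last first.
  have := h false; have := h true; rewrite /coordinate !in_itv/=.
  by move=> /andP[? ?] /andP[? ?]; rewrite !ltr_norml; split; apply/andP; split;
    lra.
by rewrite in_itv/=; move: h1 h2; case: b => /=; rewrite !ltr_norml;
  move=> /andP[? ?] /andP[? ?]; apply/andP; split; lra.
Qed.

Lemma box_slice (a : R * R) (r : R) b (x : R * R) (g : R * R -> \bar R) :
  coordinate (~~ b) x \in `](coordinate (~~ b) a - r)%R,
    (coordinate (~~ b) a + r)%R[ ->
  \int[mu1]_s (g \_ (ball a r : set RR)) (set_coordinate b s x) =
  \int[mu1]_(s in `](coordinate b a - r)%R,
    (coordinate b a + r)%R[) g (set_coordinate b s x).
Proof.
move=> xI; rewrite [RHS]integral_mkcond; apply: eq_integral => s _; rewrite !patchE.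
congr (if _ then _ else _).
apply/idP/idP; rewrite !inE.
  by move=> /ball_itv/(_ b); case: b {xI}.
by move=> sI; apply/ball_itv => b'; case: b sI xI; case: b'.
Qed.

Lemma box_slice0 (a : R * R) (r : R) b (x : R * R) (g : R * R -> \bar R) :
  coordinate (~~ b) x \notin `](coordinate (~~ b) a - r)%R,
    (coordinate (~~ b) a + r)%R[ ->
  forall s, (g \_ (ball a r : set RR)) (set_coordinate b s x) = 0.
Proof.
move=> xI s; rewrite patchE; case: ifPn => //; rewrite inE => /ball_itv/(_ (~~ b)).
by case: b xI => /= /negPf ->.
Qed.

Lemma measurable_patch2 (B : set (R * R)) (f : R * R -> R) : open B ->
  (forall x, B x -> {for x, continuous f}) ->
  measurable_fun setT ((fun z : RR => (f z)%:E) \_ (B : set RR)).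
Proof.
move=> oB cf; have mB := open_measurable2 oB.
apply: (measurable_restrictT (fun z : RR => (f z)%:E) mB).1.
by apply/measurable_EFinP; exact: measurable_fun_continuous2.
Qed.

(* [k] is the value of [v] at a point of a vertical slice on which the energy of
   [v] is at most its average over the slices. *)
Lemma box_poincare (a : R * R) (r : R) (v : R * R -> R) V (T : R) : (0 < r)%R ->
  C1grad (ball a r) v V -> bcont (ball a r) v ->
    (forall b, bcont (ball a r) (V b)) ->
  (int2 (ball a r) (dot V V) < T)%R ->
  exists k, (int2 (ball a r) (fun x => (v x - k) ^+ 2) <= 8 * r ^+ 2 * T)%R.
Proof.
move=> r0 CV nv nV DT.
set B := ball a r in CV nv nV DT *.
have oB : open B by exact: ball_open.
have mB : measurable (B : set RR) by exact: open_measurable2.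
have bB : bounded_set B by exact: bounded_ball2.
pose I b : set R := `](coordinate b a - r)%R, (coordinate b a + r)%R[%classic.
have mI b : mu1 (I b) = (2 * r)%:E.
  rewrite /I lebesgue_measure_itv/= lte_fin ifT; last by lra.
  by rewrite -EFinB; congr EFin; ring.
pose g b (z : RR) : \bar R := ((fun z => (V b z ^+ 2)%:E) \_ (B : set RR)) z.
have g0 b z : 0 <= g b z.
  by rewrite /g patchE; case: ifPn => // _; rewrite lee_fin sqr_ge0.
have nV2 b : bcont B (fun z => V b z ^+ 2)%R by exact: bcontX.
have mg b : measurable_fun setT (g b).
  by apply: measurable_patch2 => //; have [] := nV2 b.
pose D b := int2 B (fun z => V b z ^+ 2)%R.
have gD b : \int[mu2]_z g b z = (D b)%:E
  by rewrite -int2_EFin// [RHS]integral_mkcond.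
have Dge b : (0 <= D b)%R by apply: int2_ge0 => x _; exact: sqr_ge0.
have DD : (D false + D true < T)%R.
  apply: le_lt_trans DT; rewrite /D -int2D//; exact/eqW/int2_eq.
pose J t := \int[mu1]_s g false (s, t).
pose F s := \int[mu1]_t g true (s, t).
have intJ : \int[mu1]_t J t = (D false)%:E by rewrite -gD fubini_tonelli2.
have intF : \int[mu1]_s F s = (D true)%:E by rewrite -gD fubini_tonelli1.
have J0 t : 0 <= J t by exact: integral_ge0.
have F0 s : 0 <= F s by exact: integral_ge0.
have mJ : measurable_fun setT J by exact: measurable_fun_fubini_tonelli_G.
have mF : measurable_fun setT F by exact: measurable_fun_fubini_tonelli_F.
(* If all columns had energy above this value, integrating over the width [2 * r] would give at
   least [T - D false], which exceeds [D true] by [DD]. *)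
have [y yI Fy] : exists2 y, I false y & F y <= ((T - D false) / (2 * r))%:E.
  apply: contrapT => nex.
  suff : ((T - D false)%:E <= (D true)%:E) by rewrite lee_fin; lra.
  rewrite -intF; apply: (@le_trans _ _ (\int[mu1]_(s in I false) F s)).
    apply: (@le_trans _ _
      (\int[mu1]_(s in I false) (cst ((T - D false) / (2 * r))%:E s))).
      rewrite integral_cst//; last exact: measurable_itv.
      by rewrite [X in _ * X]mI -EFinM divfK// mulf_neq0// gt_eqF.
    apply: ge0_le_integral => //.
    - exact: measurable_itv.
    - move=> s _; rewrite /= lee_fin divr_ge0//; have := Dge true; lra.
    - exact: measurable_funTS.
    - move=> s sI; rewrite leNgt; apply/negP => /ltW h; apply: nex.
      by exists s.
  apply: ge0_subset_integral => //; first exact: measurable_itv.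
pose k := v (y, a.2).
exists k.
have nf : bcont B (fun z => (v z - k) ^+ 2)%R.
  by apply: bcontX; apply: bcontB => //; exact: bcont_cst.
pose f (z : RR) : \bar R := ((fun z => ((v z - k) ^+ 2)%:E) \_ (B : set RR)) z.
have f0 z : 0 <= f z.
  by rewrite /f patchE; case: ifPn => // _; rewrite lee_fin sqr_ge0.
have mf : measurable_fun setT f.
  by apply: measurable_patch2 => //; have [] := nf.
have fE : \int[mu2]_z f z = (int2 B (fun z => (v z - k) ^+ 2)%R)%:E.
  by rewrite -int2_EFin// [RHS]integral_mkcond.
have rI b : ((coordinate b a + r) - (coordinate b a - r) = 2 * r)%R by ring.
have dv z b : B z -> is_derive z (axis R b) v (V b z).
  by move=> Bz; have [_ /(_ b)[]] := CV z Bz.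
have cV z b : B z -> {for z, continuous (V b)}.
  by move=> Bz; have [_ /(_ b)[]] := CV z Bz.
have inB s t : I false s -> I true t -> B (s, t).
  by move=> sI tI; apply/ball_itv; case.
(* The path from [(s, t)] to [(y, a.2)] follows the row [t] and then the column [y]. The row
   energies [J t] integrate to at most [D false], so integrating this bound over the square gives
   [8 * r^2 * (D false + (T - D false))]. *)
have pt s t : I false s -> I true t ->
    ((v (s, t) - k) ^+ 2)%:E <= (4 * r)%:E * J t + (2 * (T - D false))%:E.
  move=> sI tI.
  have h1 : ((v (s, t) - v (y, t)) ^+ 2)%:E <= (2 * r)%:E * J t.
    have -> : J t = \int[mu1]_(u in I false) (V false (u, t) ^+ 2)%:E.
      exact: (@box_slice a r false (0%R, t)).
    rewrite -(rI false).
    apply: (@sqr_increment_le (fun u => v (u, t)) (fun u => V false (u, t))) => //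
      u uI.
      by apply: (@is_derive_slice _ _ (0%R, t) false); apply: dv; exact: inB.
    by apply: (@continuous_slice _ _ (0%R, t) false); apply: cV; exact: inB.
  have h2 : ((v (y, t) - k) ^+ 2)%:E <= (T - D false)%:E.
    apply: (@le_trans _ _ ((2 * r)%:E * F y)).
      have -> : F y = \int[mu1]_(u in I true) (V true (y, u) ^+ 2)%:E.
        exact: (@box_slice a r true (y, 0%R)).
      rewrite -(rI true).
      apply: (@sqr_increment_le (fun u => v (y, u)) (fun u => V true (y, u))) => //.
      - move=> u uI.
        by apply: (@is_derive_slice _ _ (y, 0%R) true); apply: dv; exact: inB.
      - move=> u uI.
        by apply: (@continuous_slice _ _ (y, 0%R) true); apply: cV; exact: inB.
      - by rewrite in_itv/=; apply/andP; split; lra.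
    apply: (@le_trans _ _ ((2 * r)%:E * ((T - D false) / (2 * r))%:E)).
      by rewrite lee_pmul2l ?lte_fin ?mulr_gt0.
    by rewrite -EFinM mulrC divfK// mulf_neq0// gt_eqF.
  apply: (@le_trans _ _ (2%:E * ((v (s, t) - v (y, t)) ^+ 2)%:E
      + 2%:E * ((v (y, t) - k) ^+ 2)%:E)).
    rewrite -!EFinM -EFinD lee_fin.
    rewrite -subr_ge0 (_ : (_ - _)%R
      = ((v (s, t) - v (y, t)) - (v (y, t) - k)) ^+ 2)%R.
      exact: sqr_ge0.
    by ring.
  apply: leeD; last by rewrite [leRHS]EFinM lee_pmul2l// lte_fin.
  rewrite (_ : (4 * r = 2 * (2 * r))%R); last by ring.
  by rewrite [(2 * (2 * r))%:E]EFinM -muleA lee_pmul2l// lte_fin.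
rewrite -lee_fin -fE fubini_tonelli2// /fubini_G.
have -> : \int[mu1]_t \int[mu1]_s f (s, t)
  = \int[mu1]_(t in I true) \int[mu1]_s f (s, t).
  rewrite [RHS]integral_mkcond; apply: eq_integral => t _.
  rewrite patchE; case: ifPn => // tI; rewrite integral0_eq// => s _.
  apply: (@box_slice0 a r false (0%R, t)).
  by apply: contra tI; rewrite inE.
apply: (@le_trans _ _ (\int[mu1]_(t in I true)
   ((8 * r ^+ 2)%:E * J t + (4 * r * (T - D false))%:E))).
  apply: ge0_le_integral => //.
  - exact: measurable_itv.
  - by move=> t _; exact: integral_ge0.
  - by apply: measurable_funTS; exact: measurable_fun_fubini_tonelli_G.
  - apply: measurable_funTS; apply: emeasurable_funD => //.
    exact: measurable_funeM.
  move=> t tI.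
  have -> : \int[mu1]_s f (s, t)
    = \int[mu1]_(s in I false) ((v (s, t) - k) ^+ 2)%:E.
    exact: (@box_slice a r false (0%R, t)).
  apply: (@le_trans _ _ (\int[mu1]_(s in I false)
     (cst ((4 * r)%:E * J t + (2 * (T - D false))%:E) s))).
    apply: ge0_le_integral => //.
    - exact: measurable_itv.
    - by move=> s _; rewrite lee_fin sqr_ge0.
    - apply/measurable_EFinP; apply: open_continuous_measurable_fun.
        exact: interval_open.
      move=> s; rewrite inE => sI.
      apply: (@continuous_slice _ (fun z => (v z - k) ^+ 2)%R (0%R, t) false).
      by apply: nf.1; exact: inB.
    - by move=> s sI; exact: pt.
  rewrite integral_cst//; last exact: measurable_itv.
  rewrite [X in _ * X]mI muleC ge0_muleDr//; last 2 first.
  - by rewrite mule_ge0// lee_fin; lra.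
  - by rewrite lee_fin; have := Dge true; lra.
  rewrite muleA -!EFinM.
  rewrite (_ : (2 * r * (4 * r) = 8 * r ^+ 2)%R); last by ring.
  by rewrite (_ : (2 * r * (2 * (T - D false)) = 4 * r * (T - D false))%R)//; ring.
rewrite ge0_integralD//=; last 4 first.
- exact: measurable_itv.
- by move=> t _; rewrite mule_ge0// lee_fin mulr_ge0// sqr_ge0.
- by apply: measurable_funTS; exact: measurable_funeM.
- move=> t _; rewrite lee_fin mulr_ge0//; first lra.
  by have := Dge true; lra.
rewrite integral_cst//; last exact: measurable_itv.
rewrite [X in _ + _ * X]mI ge0_integralZl//; last 3 first.
- exact: measurable_itv.
- exact: measurable_funTS.
- by rewrite lee_fin mulr_ge0// sqr_ge0.
apply: (@le_trans _ _ ((8 * r ^+ 2)%:E * (D false)%:E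
   + (4 * r * (T - D false))%:E * (2 * r)%:E)).
  apply: leeD => //; apply: lee_pmul => //.
  - by rewrite lee_fin mulr_ge0// sqr_ge0.
  - by apply: integral_ge0.
  - rewrite -intJ; apply: ge0_subset_integral => //; exact: measurable_itv.
rewrite -!EFinM -EFinD lee_fin.
by rewrite (_ : (_ + _)%R = 8 * r ^+ 2 * T)%R//; ring.
Qed.

End BoxPoincare.

(** * Gluing local Poincare inequalities *)

Section Poincare.
Variable R : realType.
Local Notation RR := (measurableTypeR R * measurableTypeR R)%type.
Local Notation mu1 := (@lebesgue_measure R).
Local Notation mu2 := (mu1 \x mu1)%E.
Implicit Types (f : R * R -> R) (x y : R * R) (A B : set (R * R)).

Lemma bcont_sub A B f : A `<=` B -> bcont B f -> bcont A f.
Proof.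
move=> AB [cf [M fM]]; split=> [x /AB|]; first exact: cf.
by exists M => x /AB; exact: fM.
Qed.

Lemma bounded_sub A B : A `<=` B -> bounded_set B -> bounded_set A.
Proof. by move=> AB [M [Mr BM]]; exists M; split=> // N /BM h x /AB; exact: h. Qed.

Lemma int2_supp A B f : A `<=` B -> (forall x, B x -> ~ A x -> f x = 0) ->
  int2 B f = int2 A f.
Proof.
move=> AB f0; rewrite /int2 [LHS]Rintegral_mkcond [RHS]Rintegral_mkcond.
apply: eq_Rintegral => x _; rewrite !patchE.
have [Ax|nAx] := pselect (A x); first by rewrite !mem_set//; exact: AB.
rewrite [x \in A]memNset//; case: ifPn => //; rewrite inE => Bx.
exact: f0.
Qed.

Lemma int2_subset A B f : open A -> open B -> bounded_set B -> A `<=` B ->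
  bcont B f -> (forall x, B x -> 0 <= f x) -> int2 A f <= int2 B f.
Proof.
move=> oA oB bB AB nf f0; rewrite -lee_fin -!int2_EFin//; last 2 first.
  exact: bounded_sub bB.
  exact: bcont_sub nf.
apply: ge0_subset_integral => //.
- exact: open_measurable2.
- exact: open_measurable2.
- by apply/measurable_EFinP; apply: measurable_fun_continuous2 => //; have [] := nf.
Qed.

Lemma int2_setU A B f : open A -> open B -> bounded_set (A `|` B) ->
  bcont (A `|` B) f -> (forall x, (A `|` B) x -> 0 <= f x) ->
  int2 (A `|` B) f <= int2 A f + int2 B f.
Proof.
move=> oA oB bAB nf f0.
have sA : A `<=` A `|` B by left.
have sB : B `<=` A `|` B by right.
have oAB : open (A `|` B) by exact: openU.
have mA := open_measurable2 oA; have mB := open_measurable2 oB.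
have mD : measurable (B `\` A : set RR) by exact: measurableD.
have mf : measurable_fun (A `|` B : set RR) (fun x : RR => (f x)%:E).
  by apply/measurable_EFinP; apply: measurable_fun_continuous2 => //; have [] := nf.
rewrite -lee_fin EFinD -!int2_EFin//; last 4 first.
- exact: bounded_sub bAB.
- exact: bcont_sub nf.
- exact: bounded_sub bAB.
- exact: bcont_sub nf.
have UD : A `|` (B `\` A) = A `|` B by rewrite setDE setUIr setUCr setIT.
rewrite -[in X in (X <= _)%E]UD.
rewrite ge0_integral_setU//=.
- apply: leeD => //; apply: ge0_subset_integral => //.
  + by apply: measurable_funS mf => //; exact: measurableU.
  + by move=> x Bx; rewrite lee_fin f0//; right.
- by rewrite UD.
- by move=> x xAB; rewrite lee_fin f0//; case: xAB => [|[]]; [left|right].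
- by apply/disj_setPS => x [Ax [_ /(_ Ax)]].
Qed.

(* [k] need not be the mean of [v]: it is found by selecting a slice with energy
   at most the average, and the slack between the energy and [T] avoids the
   case where all slices have exactly the average energy. *)
Definition poincare_on (S A : set (R * R)) := exists2 C : R, 0 <= C &
  forall v V, C1grad S v V -> bcont S v -> (forall b, bcont S (V b)) ->
  forall T : R, int2 S (dot V V) < T ->
  exists k : R, int2 A (fun x => (v x - k) ^+ 2) <= C * T.

Variable S : set (R * R).
Hypotheses (oS : open S) (bS : bounded_set S).

Let bcont_w (v : R * R -> R) k : bcont S v -> bcont S (fun x => (v x - k) ^+ 2).
Proof. by move=> nv; apply: bcontX; apply: bcontB => //; exact: bcont_cst. Qed.

Let dot_ge0 V x : 0 <= dot V V x :> R.
Proof. by rewrite addr_ge0// -expr2 sqr_ge0. Qed.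

Lemma poincare_ball (a : R * R) (r : R) : 0 < r -> ball a r `<=` S ->
  poincare_on S (ball a r).
Proof.
move=> r0 aS; exists (8 * r ^+ 2); first by rewrite mulr_ge0// sqr_ge0.
move=> v V CV nv nV T DT; apply: (@box_poincare _ _ _ _ V) => //.
- exact: C1grad_sub CV.
- exact: bcont_sub nv.
- by move=> b; exact: bcont_sub (nV b).
apply: le_lt_trans DT; apply: int2_subset => //; first exact: ball_open.
exact: bcont_dot.
Qed.

(** The constants [k] and [l] found on [A] and [B] are compared on the overlap, whose area [m] is
    positive: there [(k - l)^2 <= 2 * (v - k)^2 + 2 * (v - l)^2], and integrating gives the factor
    [E]. Then [l] is traded for [k] on [B]. *)
Lemma poincareU A B : open A -> open B -> A `<=` S -> B `<=` S ->
  A `&` B !=set0 -> poincare_on S A -> poincare_on S B -> poincare_on S (A `|` B).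
Proof.
move=> oA oB AS BS AB0 [CA CA0 PA] [CB CB0 PB].
have ABS : A `|` B `<=` S by rewrite subUset.
have IA : A `&` B `<=` A by exact: subIsetl.
have IB : A `&` B `<=` B by exact: subIsetr.
have IS : A `&` B `<=` S by exact: subset_trans IA AS.
have oI : open (A `&` B) by exact: openI.
have bA := bounded_sub AS bS; have bB := bounded_sub BS bS.
have bI := bounded_sub IS bS.
pose m := int2 (A `&` B) (fun=> 1).
have m0 : 0 < m by apply: int2_gt0 => //; exact: bcont_cst.
pose sB := int2 B (fun=> 1).
have sB0 : 0 <= sB by exact: int2_ge0.
pose E := (2 * CA + 2 * CB) / m.
have E0 : 0 <= E by rewrite divr_ge0 ?addr_ge0 ?mulr_ge0// ltW.
exists (CA + (2 * CB + 2 * E * sB)); first by apply: addr_ge0 => //;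
  apply: addr_ge0; [exact: mulr_ge0|by apply: mulr_ge0 => //; exact: mulr_ge0].
move=> v V CV nv nV T DT.
have T0 : 0 <= T by apply: le_trans (ltW DT); exact: int2_ge0.
have [k Hk] := PA _ _ CV nv nV _ DT; have [l Hl] := PB _ _ CV nv nV _ DT.
exists k.
have nk := bcont_w k nv; have nl := bcont_w l nv.
have kl : (k - l) ^+ 2 <= E * T.
  rewrite /E mulrAC ler_pdivlMr// -int2_cst//.
  apply: (@le_trans _ _ (int2 (A `&` B) (fun x =>
    2 * (v x - k) ^+ 2 + 2 * (v x - l) ^+ 2))).
    apply: int2_le => //; first exact: bcont_cst.
      by apply: bcontD; apply: bcontZ; exact: bcont_sub IS _.
    move=> x _; rewrite -subr_ge0.
    by rewrite (_ : _ - _ = ((v x - k) + (v x - l)) ^+ 2) ?sqr_ge0//; ring.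
  rewrite int2D//; [|by apply: bcontZ; exact: bcont_sub IS _..].
  rewrite !int2Z//; [|exact: bcont_sub IS _..].
  have IAk : int2 (A `&` B) (fun x => (v x - k) ^+ 2)
    <= int2 A (fun x => (v x - k) ^+ 2).
    by apply: int2_subset => // [|x _]; [exact: bcont_sub AS _|exact: sqr_ge0].
  have IBl : int2 (A `&` B) (fun x => (v x - l) ^+ 2)
    <= int2 B (fun x => (v x - l) ^+ 2).
    by apply: int2_subset => // [|x _]; [exact: bcont_sub BS _|exact: sqr_ge0].
  by lra.
apply: (@le_trans _ _ (int2 A (fun x => (v x - k) ^+ 2)
  + int2 B (fun x => (v x - k) ^+ 2))).
  apply: int2_setU => //; first exact: bounded_sub bS.
    exact: bcont_sub ABS _.
  by move=> x _; exact: sqr_ge0.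
rewrite [leRHS]mulrDl; apply: lerD => //.
apply: (@le_trans _ _ (int2 B (fun x => 2 * (v x - l) ^+ 2 + 2 * (k - l) ^+ 2))).
  apply: int2_le => //; first exact: bcont_sub BS _.
    by apply: bcontD; [apply: bcontZ; exact: bcont_sub BS _|exact: bcont_cst].
  move=> x _; rewrite -subr_ge0.
  by rewrite (_ : _ - _ = ((v x - l) + (k - l)) ^+ 2) ?sqr_ge0//; ring.
rewrite int2D//; [|by apply: bcontZ; exact: bcont_sub BS _|exact: bcont_cst].
rewrite int2Z//; last exact: bcont_sub BS _.
rewrite [X in _ + X]int2_cst//.
have : (k - l) ^+ 2 * sB <= E * T * sB by exact: ler_wpM2r.
by move: Hl; rewrite -/sB; lra.
Qed.

Hypothesis kS : connected S.

(** All admissible sets contain the same point [a], so any two overlap and can be glued. Their union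
    is open, and relatively closed since a ball around a limit point meets an admissible set and can
    be glued to it; connectedness makes it all of [S], and compactness of [K] leaves finitely many
    sets. *)
Lemma poincare_compact K : S !=set0 -> compact K -> K `<=` S ->
  exists A, [/\ open A, A `<=` S, K `<=` A & poincare_on S A].
Proof.
move=> [a Sa] cK KS.
have ballS x : S x -> exists2 r : R, 0 < r & ball x r `<=` S.
  by move=> Sx; have /nbhs_ballP[r/= r0 xr] : nbhs x S by [exact: open_nbhs_nbhs];
    exists r.
have [r0 r00 B0S] := ballS a Sa.
pose P A := [/\ open A, A `<=` S, A a & poincare_on S A].
have PU A B : P A -> P B -> P (A `|` B).
  move=> [oA AS Aa pA] [oB BS Ba pB]; split;
    [exact: openU|by rewrite subUset|by left|].
  by apply: poincareU => //; exists a.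
have P0 : P (ball a r0).
  split=> //; [exact: ball_open|exact: ballxx|exact: poincare_ball].
pose W := [set x | exists2 A, P A & A x].
have WS : W `<=` S by move=> x [A [_ AS _ _]]; exact: AS.
have oW : open W.
  rewrite openE => x [A PA Ax]; have [oA _ _ _] := PA.
  by apply: (@filterS _ _ _ A) => [y Ay|]; [exists A|exact: open_nbhs_nbhs].
have SW : W = S.
  apply: kS.
  - by exists a; exists (ball a r0) => //; exact: ballxx.
  - by exists W => //; apply/esym/setIidPr.
  - exists (closure W); first exact: closed_closure.
    apply/seteqP; split=> [x Wx|x [Sx cWx]]; first by split;
      [exact: WS|exact: subset_closure].
    have [r rp xr] := ballS x Sx.
    have [y [[A PA Ay] xry]] := cWx _ (nbhsx_ballx x r rp).
    have [oA AS Aa pA] := PA.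
    exists (A `|` ball x r); last by right; exact: ballxx.
    split; [by apply: openU => //; exact: ball_open|by rewrite subUset|by left|].
    apply: poincareU => //; [exact: ball_open|by exists y|exact: poincare_ball].
have [A [PA KA]] : exists A, P A /\ K `<=` A.
  apply: (@compact_induction _ (fun K => exists A, P A /\ K `<=` A) K) => //.
  - by move=> A B AB [D [PD BD]]; exists D; split=> //; exact: subset_trans BD.
  - by exists (ball a r0); split.
  - move=> A B [D [PD AD]] [E [PE BE]]; exists (D `|` E); split; first exact: PU.
    exact: setUSS.
  - move=> x /KS; rewrite -SW => -[A PA Ax]; have [oA _ _ _] := PA.
    by exists A; [exact: open_nbhs_nbhs|exists A; split].
by exists A; have [] := PA.
Qed.

End Poincare.

(** * The Poincare inequality up to the boundary *)

Section GlobalPoincare.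
Variables (R : realType) (S : set (R * R)) (h : R * R -> R)
  (H : bool -> R * R -> R) (HH : bool -> bool -> R * R -> R).
Hypotheses (oS : open S) (bS : bounded_set S) (kS : connected S) (S0 : S !=set0).
Hypothesis Sh : forall x, S x <-> 0 < h x.
Hypotheses (Ch : C1grad setT h H) (CH : forall b, C1grad setT (H b) (HH b)).
Hypothesis H0 : forall x, frontier S x -> 0 < dot H H x.

Let nH := bcont_H oS bS CH.
Let nh := bcont_h oS bS Ch.

(* Away from the boundary this is [poincare_compact]. The boundary layer is
   handled by [divergence_le0] for the field [(v - k)^2 h grad h]: it vanishes on
   the boundary, and [div (h grad h) = |grad h|^2 + h (laplacian h)] is bounded
   below there. *)
Lemma poincare_domain : poincare_on S S.
Proof.
have [c c0 hc] := nondegenerate oS bS Sh Ch CH H0.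
have nL : bcont S (div HH) by apply: bcontD; exact: bcont_HH.
have nHH : bcont S (dot H H) by exact: bcont_dot.
have [M ML] := nL.2; have [Mh hMh] := nh.2; have [MH hMH] := nHH.2.
pose M1 := `|M| + 1; have M10 : 0 < M1 by rewrite ltr_pwDr.
have ML1 x : S x -> `|div HH x| <= M1.
  by move=> /ML /le_trans; apply; rewrite (le_trans (ler_norm M))// lerDl.
(* Where [h <= t], [w >= c - h - h * M1 >= c - t * (1 + M1) = c / 2]. *)
pose t := c / (2 * (1 + M1)).
have t0 : 0 < t by rewrite divr_gt0// mulr_gt0// addr_gt0.
have tc : t * (1 + M1) = c / 2.
  by rewrite /t; field; rewrite gt_eqF// addr_gt0.
pose w x := dot H H x + h x * div HH x.
have nw : bcont S w by apply: bcontD => //; exact: bcontM.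
pose M2 := `|Mh| * M1.
have hw x : S x -> - M2 <= w x.
  move=> Sx; have := ML1 x Sx; rewrite ler_norml => /andP[l1 l2].
  have h0 : 0 < h x by exact/Sh.
  have d0 : 0 <= dot H H x by rewrite addr_ge0// -expr2 sqr_ge0.
  have hM : h x <= `|Mh|.
    by rewrite (le_trans (ler_norm _))// (le_trans (hMh x Sx))// ler_norm.
  have : h x * (- M1) <= h x * div HH x by rewrite ler_pM2l.
  have : h x * M1 <= M2 by rewrite ler_pM2r.
  by rewrite /w; lra.
have hw2 x : S x -> h x <= t -> c / 2 <= w x.
  move=> Sx ht; have := ML1 x Sx; rewrite ler_norml => /andP[l1 l2].
  have h0 : 0 < h x by exact/Sh.
  have : h x * (- M1) <= h x * div HH x by rewrite ler_pM2l.
  have : h x * M1 <= t * M1 by rewrite ler_pM2r.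
  have := hc x Sx; move: tc; rewrite /w mulrDr mulr1; lra.
pose K := closure S `&` [set x | t / 2 <= h x].
have cK : compact K.
  apply: (subclosed_compact _ (bounded_closure_compact bS)); last by move=> x [].
  apply: closedI; first exact: closed_closure.
  have -> : [set x | t / 2 <= h x] = h @^-1` [set y | t / 2 <= y] by [].
  apply: closed_comp; last exact: closed_ge.
  by move=> x _; have [] := Ch (x := x) I.
have KS : K `<=` S.
  by move=> x [_ /= hx]; apply/Sh; apply: lt_le_trans hx; rewrite divr_gt0.
have [A [oA AS KA [CA CA0 PA]]] := poincare_compact oS bS kS S0 cK KS.
(* Only the absolute value of the cutoff is known to be at most 1; squaring places [e] in [[0, 1]].
   It equals 1 for [h >= t], and in [S] it is supported in [K]. *)
pose e x := inner h (t / 2) x ^+ 2.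
have ne : bcont S e by apply: bcontX; exact: (bcont_inner oS bS Ch).
have t20 : 0 < t / 2 by rewrite divr_gt0.
have e1 x : e x <= 1.
  have := cutoff_norm (h x / (t / 2) - 1); rewrite /e /inner ler_norml => /andP[];
    nra.
have e_out x : h x <= t / 2 -> e x = 0 by move=> hx;
  rewrite /e inner_small// expr0n.
have e_in x : t <= h x -> e x = 1.
  by move=> hx; rewrite /e inner_large ?expr1n//; lra.
pose N := 4 / c * (`|Mh| ^+ 2 * `|MH|).
have c40 : 0 <= 4 / c by rewrite divr_ge0// ltW.
have N0 : 0 <= N.
  by apply: mulr_ge0 => //; apply: mulr_ge0 => //; exact: sqr_ge0.
have M20 : 0 <= M2 by rewrite mulr_ge0// ltW.
exists (4 / c * ((M2 + c / 2) * CA + N)).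
  apply: mulr_ge0 => //; apply: addr_ge0 => //; apply: mulr_ge0 => //; lra.
move=> v V CV nv nV T DT.
have [k Hk] := PA v V CV nv nV T DT; exists k.
pose u x := v x - k.
have nu : bcont S u by apply: bcontB => //; exact: bcont_cst.
have nf : bcont S (fun x => (v x - k) ^+ 2) by exact: bcontX.
have Cu : C1grad S u V.
  apply: (C1grad_eq oS _ _ (C1gradB CV (@C1grad_cst _ S k))) => // b x _.
  by rewrite subr0.
have sT : S `<=` setT by [].
pose YG b b' x := u x * u x * (h x * HH b b' x + H b' x * H b x)
  + (u x * V b' x + V b' x * u x) * (h x * H b x).
have CY b : C1grad S (fun x => u x * u x * (h x * H b x)) (YG b).
  apply: C1gradM; first exact: C1gradM.
  by apply: C1gradM; [exact: C1grad_sub Ch|exact: C1grad_sub (CH b)].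
have nY b : bcont S (fun x => u x * u x * (h x * H b x)).
  by apply: bcontM; exact: bcontM.
have ndVH : bcont S (dot V H) by exact: bcont_dot.
have nz : bcont S (fun x => u x * (h x * dot V H x)).
  by apply: bcontM => //; exact: bcontM.
have nr : bcont S (fun x => 2 * (u x * (h x * dot V H x))).
  exact: bcontZ.
have divE x : div YG x = (v x - k) ^+ 2 * w x + 2 * (u x * (h x * dot V H x)).
  by rewrite /div /YG /w /dot /u /div; ring.
have nfw : bcont S (fun x => (v x - k) ^+ 2 * w x) by exact: bcontM.
have nD : bcont S (div YG) by rewrite (funext divE); exact: bcontD.
have key : int2 S (div YG) <= 0.
  apply: (divergence_le0 oS bS Sh Ch CH H0 CY nY nD) => x d fx d0.
  near=> y => Sy; apply: (@le_trans _ _ 0); first by rewrite oppr_le0 ltW.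
  rewrite (_ : dot _ _ y = u y ^+ 2 * h y * dot H H y); last by rewrite /dot; ring.
  apply: mulr_ge0; last by rewrite addr_ge0// -expr2 sqr_ge0.
  by apply: mulr_ge0; [exact: sqr_ge0|exact/ltW/Sh].
rewrite (@int2_eq _ _ _ _ (fun x _ => divE x)) int2D// in key.
rewrite [X in _ + X <= _]int2Z// in key.
have ndV : bcont S (dot V V) by exact: bcont_dot.
have nef : bcont S (fun x => e x * (v x - k) ^+ 2) by exact: bcontM.
(* Where [h >= t], [e = 1] and the factor [M2 + c / 2] compensates [w >= - M2]; elsewhere
   [w >= c / 2] is enough. *)
have step : int2 S (fun x => c / 2 * (v x - k) ^+ 2) <=
    int2 S (fun x => (v x - k) ^+ 2 * w x + (M2 + c / 2) * (e x * (v x - k) ^+ 2)).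
  apply: int2_le => //; first exact: bcontZ.
    by apply: bcontD => //; exact: bcontZ.
  move=> x Sx; have f0 : 0 <= (v x - k) ^+ 2 by exact: sqr_ge0.
  have [ht|ht] := leP t (h x).
    rewrite e_in// mul1r mulrC; have := hw x Sx; nra.
  have := hw2 x Sx (ltW ht).
  have : 0 <= e x * (v x - k) ^+ 2 by rewrite mulr_ge0// sqr_ge0.
  have : 0 <= M2 + c / 2 by rewrite addr_ge0// divr_ge0// ltW.
  by move: (e x * (v x - k) ^+ 2) => z; nra.
(* Young's inequality with weight [c / 4], half of the coefficient on the left of [step], so that
   the term in [(v - k)^2] can be absorbed. *)
have young : int2 S (fun x => - (2 * (u x * (h x * dot V H x)))) <=
    int2 S (fun x => c / 4 * (v x - k) ^+ 2 + N * dot V V x).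
  apply: int2_le => //; first exact: bcontN.
    by apply: bcontD; exact: bcontZ.
  move=> x Sx.
  have CS : dot V H x ^+ 2 <= dot V V x * dot H H x.
    rewrite -subr_ge0 (_ : _ - _
      = (V false x * H true x - V true x * H false x) ^+ 2).
      exact: sqr_ge0.
    by rewrite /dot; ring.
  have dV0 : 0 <= dot V V x by rewrite addr_ge0// -expr2 sqr_ge0.
  have hx2 : h x ^+ 2 <= `|Mh| ^+ 2.
    rewrite -[h x ^+ 2]ger0_norm ?sqr_ge0// normrX lerXn2r ?nnegrE//.
    by rewrite (le_trans (hMh x Sx))// ler_norm.
  have Hx : dot H H x <= `|MH|.
    by rewrite (le_trans (ler_norm _))// (le_trans (hMH x Sx))// ler_norm.
  have z2 : (h x * dot V H x) ^+ 2 <= `|Mh| ^+ 2 * `|MH| * dot V V x.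
    rewrite exprMn -mulrA; apply: ler_pM; rewrite ?sqr_ge0//.
    by apply: (le_trans CS); rewrite mulrC ler_wpM2r.
  have : 0 <= c / 4 * (u x + 4 / c * (h x * dot V H x)) ^+ 2.
    by rewrite mulr_ge0 ?sqr_ge0// divr_ge0// ltW.
  rewrite (_ : c / 4 * _ = c / 4 * (v x - k) ^+ 2 + 2 * (u x * (h x * dot V H x))
      + 4 / c * (h x * dot V H x) ^+ 2); last first.
    by rewrite /u; field; rewrite gt_eqF.
  have : 4 / c * (h x * dot V H x) ^+ 2 <= N * dot V V x.
    by rewrite /N -[leRHS]mulrA ler_wpM2l.
  lra.
have eA : int2 S (fun x => e x * (v x - k) ^+ 2) <= CA * T.
  rewrite (int2_supp AS); last first.
    move=> x Sx nAx; rewrite e_out ?mul0r// leNgt; apply/negP => /ltW hx.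
    by apply/nAx/KA; split=> //; exact: subset_closure.
  apply: le_trans Hk; apply: int2_le => //; first exact: bounded_sub bS.
  - exact: bcont_sub nef.
  - exact: bcont_sub nf.
  - by move=> x _; rewrite ler_piMl ?sqr_ge0.
rewrite int2Z// int2D// in step; last exact: bcontZ.
rewrite int2Z// in step.
rewrite -[in X in X <= _](@int2_eq _ _
  (fun x => -1 * (2 * (u x * (h x * dot V H x))))) in young; last first.
  by move=> x _; rewrite mulN1r.
rewrite int2Z// int2D// in young; [|exact: bcontZ..].
rewrite !int2Z// in young.
set F := int2 S (fun x => (v x - k) ^+ 2) in step young *.
have c4 : c / 4 * F <= ((M2 + c / 2) * CA + N) * T.
  have : N * int2 S (dot V V) <= N * T by rewrite ler_wpM2l// ltW.
  have : (M2 + c / 2) * int2 S (fun x => e x * (v x - k) ^+ 2)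
    <= (M2 + c / 2) * (CA * T).
    by rewrite ler_wpM2l// addr_ge0// divr_ge0// ltW.
  move: key step young; lra.
rewrite (_ : F = 4 / c * (c / 4 * F)); last by field; rewrite gt_eqF.
by rewrite -[leRHS]mulrA ler_wpM2l.
Unshelve. all: by end_near. Qed.

End GlobalPoincare.

(** * A global defining function of the domain *)

Section Geometry.
Variable R : realType.
Variable S : set (R * R).
Hypothesis oS : open S.
Implicit Types (x y n : R * R).

Definition dotv n (H : bool -> R) :=
  coordinate false n * H false + coordinate true n * H true.

Definition C1fun (f : R * R -> R) := exists G, C1grad setT f G.

Lemma C1fun_cst k : C1fun (fun=> k).
Proof. by eexists; exact: C1grad_cst. Qed.

Lemma C1funD f g : C1fun f -> C1fun g -> C1fun (fun x => f x + g x).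
Proof. by move=> [F CF] [G CG]; eexists; exact: C1gradD CF CG. Qed.

Lemma C1funM f g : C1fun f -> C1fun g -> C1fun (fun x => f x * g x).
Proof. by move=> [F CF] [G CG]; eexists; exact: C1gradM CF CG. Qed.

Lemma C1fun_comp f (phi dphi : R -> R) :
  (forall t : R, is_derive t 1 phi (dphi t)) ->
  continuous dphi -> C1fun f -> C1fun (fun x => phi (f x)).
Proof.
move=> dP cP [F Cf]; eexists; apply: (C1grad_comp (dphi := dphi) _ Cf) => x _.
by split; [exact: dP|exact: cP].
Qed.

Lemma C1fun_coord b : C1fun (@coordinate R b).
Proof. by eexists; exact: C1grad_coord. Qed.

Section Bump.
Variables (a : R * R) (r : R).

Definition paraboloid x : R :=
  r ^+ 2 - ((x.1 - a.1) ^+ 2 + (x.2 - a.2) ^+ 2).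

Lemma C1grad_paraboloid :
  C1grad setT paraboloid (fun b x => - 2 * (coordinate b x - coordinate b a)).
Proof.
have C1 b : C1grad setT (fun x => coordinate b x - coordinate b a) (fun b' _ =>
  (b == b')%:R - 0).
  by apply: C1gradB; [exact: C1grad_coord|exact: C1grad_cst].
have C2 b := C1gradM (C1 b) (C1 b).
apply: (C1grad_eq openT _ _
  (C1gradB (@C1grad_cst R setT (r ^+ 2)) (C1gradD (C2 false) (C2 true)))).
  by move=> x _; rewrite /paraboloid /= !expr2.
by case=> x _ /=; ring.
Qed.

(** The cube of the positive part of [r^2 - |x - a|^2]: the power 3 is what makes the gradient C1
    again, as needed for [grad h]. *)
Definition bump x : R := ppow 2 (paraboloid x).
Definition dbump b x : R :=
  3 * ppow 1 (paraboloid x) * (- 2 * (coordinate b x - coordinate b a)).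

Lemma C1grad_bump : C1grad setT bump dbump.
Proof.
apply: (C1grad_comp (dphi := fun t => 3 * ppow 1 t) _ C1grad_paraboloid) => x _.
split; first exact: is_derive_ppow.
by apply: cvgM; [exact: cvg_cst|exact: continuous_ppow].
Qed.

Lemma C1fun_dbump b : C1fun (dbump b).
Proof.
apply: C1funM.
  apply: C1funM; first exact: C1fun_cst.
  apply: (C1fun_comp (dphi := fun t => 2 * ppow 0 t)).
  - exact: is_derive_ppow.
  - by move=> t; apply: cvgM; [exact: cvg_cst|exact: continuous_ppow].
  - by eexists; exact: C1grad_paraboloid.
apply: C1funM; first exact: C1fun_cst.
by apply: C1funD; [exact: C1fun_coord|exact: C1fun_cst].
Qed.

Lemma bump_ge0 x : 0 <= bump x. Proof. exact: ppow_ge0. Qed.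

Lemma bump_ball x : 0 < r -> 0 < bump x -> ball a r x.
Proof.
rewrite ppow_gt0 /paraboloid subr_gt0 => r0 h; apply/in_ball.
have s1 := sqr_ge0 (x.1 - a.1); have s2 := sqr_ge0 (x.2 - a.2).
by rewrite !ltr_norml; split; apply/andP; split; nra.
Qed.

Lemma bump_nbhs : 0 < r -> nbhs a [set x | 0 < bump x].
Proof.
move=> r0; have [cb _] := C1grad_bump (x := a) I.
apply: (cvgr_gt _ cb); rewrite ppow_gt0 /paraboloid !subrr expr0n/= addr0 subr0.
by rewrite exprn_gt0.
Qed.

Lemma bump0 x : bump x = 0 -> forall b, dbump b x = 0.
Proof.
move=> b0 b; rewrite /dbump ppow_le0 ?mulr0 ?mul0r//.
by rewrite leNgt -(ppow_gt0 2) -/(bump x) b0 ltxx.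
Qed.

End Bump.

(* All the conditions on [(h, H, m)] are stable under addition, so that local
   defining functions multiplied by bump functions can simply be summed. The
   condition on [q] and [tau] says that [grad h] is [- m] times a combination of
   outer normals; two charts at [x] are not compared at this point. *)
Definition collar (A : set (R * R)) (h : R * R -> R) (H : bool -> R * R ->
  R) (m : R * R -> R) :=
  [/\ [/\ C1grad setT h H, forall b, C1fun (H b) & C1fun m],
      [/\ forall x, 0 < h x -> S x, forall x, S x -> 0 <= h x &
          forall x, A x -> S x -> 0 < h x],
      forall x, 0 <= m x,
      forall x (q : bool -> R) (tau : R), frontier S x ->
        (forall n, unit_outer_normal S x n -> dotv n q = - tau) ->
        H false x * q false + H true x * q true = m x * tau &
      forall x, frontier S x ->
        (forall n, unit_outer_normal S x n -> dotv n (H^~ x) <= 0) /\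
        (A x -> exists2 n, unit_outer_normal S x n & dotv n (H^~ x) < 0)].

Lemma collarU A B h H m h' H' m' : collar A h H m -> collar B h' H' m' ->
  collar (A `|` B) (fun x => h x + h' x) (fun b x => H b x + H' b x) (fun x =>
    m x + m' x).
Proof.
move=> [[Ch CH Cm] [hS Sh Ah] m0 Rq N] [[Ch' CH' Cm'] [hS' Sh' Bh'] m0' Rq' N'].
split.
- split; [exact: C1gradD|by move=> b; exact: C1funD|exact: C1funD].
- split.
  + move=> x hx; have [/hS//|h0] := ltP 0 (h x); apply: hS'; lra.
  + by move=> x Sx; rewrite addr_ge0 ?Sh ?Sh'.
  + move=> x [Ax|Bx] Sx; first by rewrite ltr_wpDr ?Sh' ?Ah.
    by rewrite ltr_wpDl ?Sh ?Bh'.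
- by move=> x; rewrite addr_ge0.
- move=> x q tau fx hq; have := Rq x q tau fx hq; have := Rq' x q tau fx hq; lra.
- move=> x fx; have [N1 N2] := N x fx; have [N1' N2'] := N' x fx.
  have dD n : dotv n (fun b => H b x + H' b x) = dotv n (H^~ x) + dotv n (H'^~ x).
    by rewrite /dotv; ring.
  split=> [n un|[/N2|/N2'] [n un hn]].
  + by rewrite dD; have := N1 n un; have := N1' n un; lra.
  + by exists n; rewrite // dD; have := N1' n un; lra.
  + by exists n; rewrite // dD; have := N1 n un; lra.
Qed.

Lemma collar_sub A B h H m : A `<=` B -> collar B h H m -> collar A h H m.
Proof.
move=> AB [C [hS Sh Bh] m0 Rq N]; split=> //.
- by split=> // x /AB; exact: Bh.
- by move=> x fx; have [N1 N2] := N x fx; split=> // /AB.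
Qed.

Lemma collar0 : collar set0 (fun=> 0) (fun _ _ => 0) (fun=> 0).
Proof.
split=> //.
- by split=> [|b|]; [exact: C1grad_cst|exact: C1fun_cst..].
- by split=> // x; rewrite ltxx.
- by move=> x q tau _ _; rewrite !mul0r addr0.
- by move=> x _; split=> // n _; rewrite /dotv !mulr0 addr0.
Qed.

(** On the frontier [rho = 0], so the gradient of the product is the bump times [P], that is
    [- (bump * q)] times an outer normal; this is the origin of the weight [bump * q]. Where the
    bump vanishes so does its gradient, and nothing is to be checked. *)
Lemma collar_local (a : R * R) (r : R) (rho : R * R -> R) P
  (q : R * R -> R) :
  0 < r ->
  C1grad setT rho P -> (forall b, C1fun (P b)) -> C1fun q -> (forall x, 0 < q x) ->
  (forall x, ball a r x -> S x <-> 0 < rho x) ->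
  (forall x, ball a r x -> frontier S x -> rho x = 0 /\
    exists n, [/\ unit_outer_normal S x n,
      forall b, P b x = - (q x * coordinate b n),
      0 < dotv n (fun b => coordinate b n) &
      forall n', unit_outer_normal S x n' ->
        0 <= dotv n' (fun b => coordinate b n)]) ->
  collar [set x | 0 < bump a r x] (fun x => bump a r x * rho x)
    (fun b x => bump a r x * P b x + dbump a r b x * rho x)
    (fun x => bump a r x * q x).
Proof.
move=> r0 Crho CP Cq q0 Srho fr.
have bb x : 0 < bump a r x -> ball a r x by exact: bump_ball.
have b0 x : bump a r x = 0 \/ 0 < bump a r x.
  by have := bump_ge0 a r x; rewrite le_eqVlt => /predU1P[<-|]; [left|right].
have C1b : C1fun (bump a r) by eexists; exact: C1grad_bump.
split.
- split; first by apply: C1gradM => //; exact: C1grad_bump.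
    move=> b; apply: C1funD; first exact: C1funM.
    by apply: C1funM; [exact: C1fun_dbump|eexists; exact: Crho].
  exact: C1funM.
- split.
  + move=> x; have [->|bx] := b0 x; first by rewrite mul0r ltxx.
    by rewrite pmulr_rgt0// => /(Srho x (bb x bx)).
  + move=> x Sx; have [->|bx] := b0 x; first by rewrite mul0r.
    by rewrite mulr_ge0 ?bump_ge0// ltW//; apply/(Srho x (bb x bx)).
  + by move=> x bx Sx; rewrite mulr_gt0//; apply/(Srho x (bb x bx)).
- by move=> x; rewrite mulr_ge0 ?bump_ge0 ?ltW.
- move=> x v tau fx hv; have [bx|bx] := b0 x.
    by rewrite bx !(bump0 bx) !mul0r !addr0 !mul0r addr0.
  have [rho0 [n [un Pn nn _]]] := fr x (bb x bx) fx.
  have := hv n un; rewrite rho0 !mulr0 !addr0 !Pn /dotv => h.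
  rewrite (_ : _ + _
    = - (bump a r x * q x)
      * (coordinate false n * v false + coordinate true n * v true)).
    by rewrite h; ring.
  by ring.
- move=> x fx; have [bx|bx] := b0 x.
    split=> [n un|/=]; last by rewrite bx ltxx.
    by rewrite /dotv bx !(bump0 bx) !mul0r !addr0 !mulr0 addr0.
  have [rho0 [n [un Pn nn nn']]] := fr x (bb x bx) fx.
  have E n' : dotv n' (fun b => bump a r x * P b x + dbump a r b x * rho x) =
      - (bump a r x * q x) * dotv n' (fun b => coordinate b n).
    by rewrite /dotv rho0 !Pn; ring.
  have bq : 0 < bump a r x * q x by rewrite mulr_gt0.
  split=> [n' un'|_].
    by rewrite E mulNr oppr_le0 mulr_ge0 ?(ltW bq)// nn'.
  by exists n; rewrite // E mulNr oppr_lt0 mulr_gt0.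
Qed.

End Geometry.

(** * Boundary charts and their normals *)

Section Charts.
Variable R : realType.
Variable S : set (R * R).
Hypothesis oS : open S.
Implicit Types (x y n e : R * R).

Lemma derive_pos (phi : R -> R) (d : R) : is_derive (0 : R) 1 phi d -> phi 0 = 0 ->
  0 < d -> \forall t \near 0^'+, 0 < phi t.
Proof.
move=> [dphi dE] phi0 d0.
have cv : h^-1 *: ((phi \o shift 0) (h *: 1) - phi 0) @[h --> 0^'] --> d.
  by rewrite -dE; exact: dphi.
have hq : \forall h \near (0 : R), h != 0 ->
    0 < h^-1 *: ((phi \o shift 0) (h *: 1) - phi 0) by exact: (cvgr_gt _ cv).
suff : \forall t \near (0 : R), 0 < t -> 0 < phi t by [].
apply: filterS hq => t hq t0.
have := hq (lt0r_neq0 t0); rewrite /= phi0 addr0 subr0 [t *: 1]mulr1.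
by rewrite pmulr_rgt0// invr_gt0.
Qed.

Variables (b s : bool) (g : R -> R).
Hypothesis sg : smooth g.

Definition chart_fun x : R :=
  (-1) ^+ s * (coordinate b x - g (coordinate (~~ b) x)).
Definition chart_grad b' x : R :=
  (-1) ^+ s * ((b == b')%:R - derive1 g (coordinate (~~ b) x) * (~~ b == b')%:R).
Definition chart_norm x : R := Num.sqrt (1 + derive1 g (coordinate (~~ b) x) ^+ 2).

Lemma smooth_derive k (t : R) : is_derive t 1 (derive1n k g) (derive1n k.+1 g t).
Proof. by rewrite derive1nS derive1E; apply: derivableP; exact: sg. Qed.

Lemma smooth_continuous k : continuous (derive1n k g).
Proof. by move=> t; apply: differentiable_continuous; apply/derivable1_diffP;
  exact: sg. Qed.

Lemma C1grad_chart : C1grad setT chart_fun chart_grad.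
Proof.
have Cg : C1grad setT (fun x => g (coordinate (~~ b) x))
    (fun b' x => derive1 g (coordinate (~~ b) x) * (~~ b == b')%:R).
  apply: (C1grad_comp (dphi := derive1 g) _ (@C1grad_coord R setT (~~ b))) => x _.
  by split; [exact: (smooth_derive 0)|exact: (@smooth_continuous 1)].
exact: (C1gradZ _ (C1gradB (@C1grad_coord R setT b) Cg)).
Qed.

Lemma C1fun_chart_grad b' : C1fun (chart_grad b').
Proof.
apply: C1funM; first exact: C1fun_cst.
have C1 : C1fun (fun x => derive1 g (coordinate (~~ b) x)).
  apply: (C1fun_comp (dphi := derive1n 2 g)); last exact: C1fun_coord.
    exact: (smooth_derive 1).
  exact: smooth_continuous.
have C2 : C1fun (fun x =>
  derive1 g (coordinate (~~ b) x) * ((-1) * (~~ b == b')%:R)).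
  by apply: C1funM => //; exact: C1fun_cst.
have [G CG] := C1funD (@C1fun_cst R (b == b')%:R) C2.
by exists G; apply: (C1grad_eq openT _ _ CG) => // x _; rewrite mulN1r mulrN.
Qed.

Lemma chart_norm_gt0 x : 0 < chart_norm x.
Proof. by rewrite sqrtr_gt0 ltr_pwDl// sqr_ge0. Qed.

Lemma C1fun_chart_norm : C1fun chart_norm.
Proof.
have C1 : C1fun (fun x => derive1 g (coordinate (~~ b) x)).
  apply: (C1fun_comp (dphi := derive1n 2 g)); last exact: C1fun_coord.
    exact: (smooth_derive 1).
  exact: smooth_continuous.
have [G CG] := C1funD (@C1fun_cst R 1) (C1funM C1 C1).
eexists; apply: (C1grad_eq openT _ _ (C1grad_comp (phi := Num.sqrt) (dphi :=
  fun t => (2 * Num.sqrt t)^-1) _ CG)).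
- by move=> x _; rewrite /chart_norm expr2.
- by move=> b' x _; reflexivity.
move=> x _; set t := 1 + _.
have t0 : 0 < t by rewrite ltr_pwDl// -expr2 sqr_ge0.
split; first exact: is_derive1_sqrt.
apply: cvgV; first by rewrite mulf_neq0// sqrtr_eq0 -ltNge.
by apply: cvgM; [exact: cvg_cst|exact: sqrt_continuous].
Qed.

Lemma chart_line x e : is_derive (0 : R) 1 (fun t : R => chart_fun (t *: e + x))
  (dotv e (chart_grad^~ x)).
Proof.
have dc (c : bool) :
  is_derive (0 : R) 1 (fun t : R => coordinate c (t *: e + x)) (coordinate c e).
  have -> : (fun t : R => coordinate c (t *: e + x))
    = (fun t => t * coordinate c e + coordinate c x).
    by apply/funext => t; case: c.
  by apply: is_derive_eq; rewrite scaler0 add0r addr0 [_ *: 1]mulr1.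
have dg : is_derive (0 : R) 1 (fun t : R => g (coordinate (~~ b) (t *: e + x)))
    (derive1 g (coordinate (~~ b) x) * coordinate (~~ b) e).
  apply: (@is_derive1_comp _ g (fun t : R => coordinate (~~ b) (t *: e + x))) => //.
  by rewrite scale0r add0r; exact: (smooth_derive 0).
have db := dc b.
apply: is_derive_eq; rewrite -[_ *: _]/(_ * _).
by rewrite /dotv /chart_grad; case: (b) => /=; ring.
Qed.

Lemma chart_near x : boundary_chart S x b s g ->
  chart_fun x = 0 /\ \forall y \near x, S y <-> 0 < chart_fun y.
Proof. by move=> [_ xg nS]; split=> //; rewrite /chart_fun xg subrr mulr0. Qed.

(** A chart at one point serves at the nearby frontier points: a positive value of [chart_fun] would
    put [y] in the open set [S], a negative one would keep [S] away from [y]. *)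
Lemma chart_frontier y :
  (\forall z \near y, S z <-> 0 < chart_fun z) -> frontier S y ->
  boundary_chart S y b s g /\ chart_fun y = 0.
Proof.
move=> nS [cSy niS].
have cc : {for y, continuous chart_fun} by have [] := C1grad_chart (x := y) I.
have nSy : ~ S y by move=> Sy; apply: niS; exact: open_nbhs_nbhs.
have y0 : chart_fun y = 0.
  apply/eqP; rewrite eq_le; apply/andP; split.
    by rewrite leNgt; apply/negP; rewrite -(nbhs_singleton nS).
  rewrite leNgt; apply/negP => ylt.
  have /cSy[z [Sz /= [zS zlt]]] : \forall z \near y, (S z <-> 0 < chart_fun z) /\
    chart_fun z < 0.
    by apply: filterI => //; exact: (cvgr_lt _ cc).
  by move: (lt_trans zlt (zS.1 Sz)); rewrite ltxx.
split=> //; split=> //.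
move/eqP: y0; rewrite /chart_fun mulf_eq0 signr_eq0/= subr_eq0 => /eqP.
exact.
Qed.

Definition chart_normal x : R * R :=
  let nb := - (-1) ^+ s / chart_norm x in
  let nb' := (-1) ^+ s * derive1 g (coordinate (~~ b) x) / chart_norm x in
  if b then (nb', nb) else (nb, nb').

Lemma chart_normalP x : boundary_chart S x b s g ->
  unit_outer_normal S x (chart_normal x).
Proof.
move=> xc; exists b, s, g; split=> //; rewrite /chart_normal /chart_norm.
  by case: (b).
by case: (b).
Qed.

Lemma chart_normal_uniq x n : coordinate b n = - (-1) ^+ s / chart_norm x ->
  coordinate (~~ b) n
    = (-1) ^+ s * derive1 g (coordinate (~~ b) x) / chart_norm x ->
  n = chart_normal x.
Proof. by rewrite /chart_normal; case: n => n1 n2; case: (b) => /= -> ->. Qed.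

Lemma chart_gradE x b' : chart_grad b' x
  = - (chart_norm x * coordinate b' (chart_normal x)).
Proof.
have q0 : chart_norm x != 0 by rewrite gt_eqF// chart_norm_gt0.
by rewrite /chart_grad /chart_normal; case: (b); case: b' => /=; field.
Qed.

Lemma chart_normal_neq0 x :
  0 < dotv (chart_normal x) (fun c => coordinate c (chart_normal x)).
Proof.
have q0 : chart_norm x != 0 by rewrite gt_eqF// chart_norm_gt0.
have : chart_normal x != 0.
  apply/eqP => n0; have := chart_gradE x b; rewrite n0 /chart_grad eqxx.
  have -> : coordinate b (0 : R * R) = 0 by case: (b).
  have -> : (~~ b == b) = false by case: (b).
  by rewrite mulr0 subr0 mulr1 mulr0 oppr0 => /eqP; rewrite signr_eq0.
rewrite /dotv /=; case: (chart_normal x) => n1 n2 /= nn.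
rewrite lt_def -!expr2 addr_ge0 ?sqr_ge0// andbT paddr_eq0 ?sqr_ge0// !sqrf_eq0.
by apply: contra nn => /andP[/eqP-> /eqP->].
Qed.

End Charts.

(** * Existence of the defining function *)

Section CollarExistence.
Variable R : realType.
Variable S : set (R * R).
Hypothesis SD : bounded_smooth_domain S.
Let oS : open S. Proof. by case: SD. Qed.

(* Otherwise, moving from [x] in the direction [- n] enters [S] for one chart and
   leaves it for the other. *)
Lemma outer_normals_dot_ge0 (x n n' : R * R) : unit_outer_normal S x n ->
  unit_outer_normal S x n' -> 0 <= dotv n' (fun c => coordinate c n).
Proof.
move=> [b [s [g [xc nb nb']]]] [c [s' [g' [xc' nc nc']]]].
have sg : smooth g by case: xc.
have sg' : smooth g' by case: xc'.
rewrite (chart_normal_uniq nb nb') (chart_normal_uniq nc nc').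
set nn := chart_normal b s g x; set nn' := chart_normal c s' g' x.
rewrite leNgt; apply/negP => neg.
have [x0 xS] := chart_near xc; have [x0' xS'] := chart_near xc'.
pose e : R * R := (- nn.1, - nn.2).
have d1 := chart_line b s sg x e; have d2 := chart_line c s' sg' x e.
have q0 := chart_norm_gt0 b g x; have q0' := chart_norm_gt0 c g' x.
have p1 : 0 < dotv e (chart_grad b s g ^~ x).
  rewrite (_ : dotv _ _ = chart_norm b g x * dotv nn (fun c => coordinate c nn)).
    by rewrite mulr_gt0// chart_normal_neq0.
  by rewrite /dotv !chart_gradE /=; ring.
have p2 : 0 < - dotv e (chart_grad c s' g' ^~ x).
  rewrite (_ : dotv _ _ = chart_norm c g' x * dotv nn' (fun c => coordinate c nn)).
    by rewrite -mulrN mulr_gt0// oppr_gt0.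
  by rewrite /dotv !chart_gradE /=; ring.
have line_cvg : (fun t : R => t *: e + x) t @[t --> (0 : R)^'+] --> x.
  apply: cvg_at_right_filter.
  rewrite -[X in _ --> X]add0r -[X in X + _](scale0r e).
  by apply: cvgD; [apply: cvgZl; exact: cvg_id|exact: cvg_cst].
have n1 : \forall t \near 0^'+, 0 < chart_fun b s g (t *: e + x).
  by apply: (derive_pos d1) => //; rewrite scale0r add0r.
have n2 : \forall t \near 0^'+, 0 < - chart_fun c s' g' (t *: e + x).
  apply: (derive_pos (d := - dotv e (chart_grad c s' g' ^~ x))) => //.
  by rewrite scale0r add0r x0' oppr0.
have [t [[[t1 t2] t3] t4]] : exists t, ((0 < chart_fun b s g (t *: e + x) /\
    0 < - chart_fun c s' g' (t *: e + x)) /\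
    (S (t *: e + x) <-> 0 < chart_fun b s g (t *: e + x))) /\
    (S (t *: e + x) <-> 0 < chart_fun c s' g' (t *: e + x)).
  apply: (@filter_ex _ (0 : R)^'+).
  apply: filterI; last exact: line_cvg xS'.
  apply: filterI; last exact: line_cvg xS.
  exact: filterI.
have := t4.1 (t3.2 t1); lra.
Qed.

(** Local collars are summed by [compact_induction] over the closure. Their gradients cannot cancel
    on the frontier, because normals coming from different charts have nonnegative product. *)
Lemma collar_exists : exists h H m, collar S (closure S) h H m.
Proof.
have [_ _ _ bS fS] := SD.
apply: (@compact_induction _ (fun A => exists h H m, collar S A h H m)).
- by move=> A B AB [h [H [m hm]]]; exists h, H, m; exact: collar_sub hm.
- by do 3 eexists; exact: collar0.
- move=> A B [h [H [m hm]]] [h' [H' [m' hm']]].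
  by do 3 eexists; exact: collarU hm hm'.
- exact: bounded_closure_compact.
move=> x cSx; have [Sx|nSx] := pselect (S x).
  have /nbhs_ballP[r/= r0 xr] : nbhs x S by exact: open_nbhs_nbhs.
  exists [set y | 0 < bump x r y]; first exact: bump_nbhs.
  (* Inside [S] the constant 1 is a local defining function; the ball contains no frontier point, so
     the conditions on normals are void. *)
  do 3 eexists; apply: (@collar_local _ S x r (fun=> 1) (fun _ _ => 0) (fun=> 1))
    => //.
  - exact: C1grad_cst.
  - by move=> b; exact: C1fun_cst.
  - exact: C1fun_cst.
  - by move=> y /xr.
  - by move=> y /xr Sy [_] []; exact: open_nbhs_nbhs.
have fx : frontier S x by split=> // /interior_subset.
have [b [s [g xc]]] := fS x fx.
have sg : smooth g by case: xc.
have [x0 /nbhs_ballP[r/= r0 xr]] := chart_near xc.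
exists [set y | 0 < bump x r y]; first exact: bump_nbhs.
do 3 eexists; apply:
  (@collar_local _ S x r (chart_fun b s g) (chart_grad b s g) (chart_norm b g)) =>
    //.
- exact: C1grad_chart.
- by move=> b'; exact: C1fun_chart_grad.
- exact: C1fun_chart_norm.
- by move=> y; exact: chart_norm_gt0.
move=> y xy fy.
have nS : \forall z \near y, S z <-> 0 < chart_fun b s g z.
  have : nbhs y (ball x r) by apply: open_nbhs_nbhs; split=> //; exact: ball_open.
  by apply: filterS => z /xr.
have [yc y0] := chart_frontier oS sg nS fy; split=> //.
exists (chart_normal b s g y); split.
- exact: chart_normalP.
- by move=> b'; exact: chart_gradE.
- exact: chart_normal_neq0.
- by move=> n'; apply: outer_normals_dot_ge0; exact: chart_normalP.
Qed.

(** The only geometric input of the estimates. The last clause turns a condition on all outer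
    normals, such as the Robin condition, into one on [grad h], after which normals no longer
    occur. *)
Lemma defining_function : exists h H HH m M,
  [/\ forall x, S x <-> 0 < h x,
      [/\ C1grad setT h H, forall b, C1grad setT (H b) (HH b) & C1grad setT m M],
      forall x, 0 <= m x,
      forall x, frontier S x -> 0 < dot H H x &
      forall x (q : bool -> R) (tau : R), frontier S x ->
        (forall n, unit_outer_normal S x n -> dotv n q = - tau) ->
        H false x * q false + H true x * q true = m x * tau].
Proof.
have [h [H [m [[Ch CH [M Cm]] [hS Sh cSh] m0 Rq N]]]] := collar_exists.
have [G0 CG0] := CH false; have [G1 CG1] := CH true.
exists h, H, (fun b => if b then G1 else G0), m, M; split=> //.
- by move=> x; split=> [Sx|/hS//]; apply: cSh => //; exact: subset_closure.
- by split=> //; case.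
move=> x fx; have [_ /(_ fx.1)[n _]] := N x fx.
rewrite /dotv /dot -!expr2 => nH.
rewrite lt_def addr_ge0 ?sqr_ge0// andbT paddr_eq0 ?sqr_ge0// !sqrf_eq0.
by apply/negP => /andP[/eqP h0 /eqP h1]; move: nH; rewrite h0 h1 !mulr0 addr0 ltxx.
Qed.

End CollarExistence.

(** * Energy estimates *)

Section Absorption.
Variable R : realType.

(* [E] is the energy, [W] the integral of [(P - k)^2] and [sg] the area. *)
Lemma absorption (a p sg : R) : 0 < a -> 1 <= p -> 0 < sg ->
  exists2 al0 : R, 0 < al0 & exists2 K : R, 0 <= K &
  forall al c k E W Phi : R, 0 <= al -> al <= al0 -> 0 <= c -> 0 <= E ->
    W <= p * E ->
    c ^+ 2 * sg <= 3 * al ^+ 2 * a ^+ 2 * (W + k ^+ 2 * sg + E) ->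
    (k * sg) ^+ 2 <= 2 * Phi ^+ 2 + 2 * sg * W ->
    (forall e : R, 0 < e -> E <= (2 * e + 2 * al * a) * W + (al * a + 4^-1) * E
      + sg * (c ^+ 2 / (4 * e) + al ^+ 2 * k ^+ 2 * a ^+ 2 * ((4 * e)^-1 + 1))) ->
    E <= K * al ^+ 2 * Phi ^+ 2.
Proof.
move=> a0 p1 sg0.
have p0 : 0 < p by apply: lt_le_trans p1.
(* Eliminating [c] and then [k] leaves [E <= al^2 * K1 * E + K2 * al^2 * Phi^2], which is [h9]. *)
pose K1 := a ^+ 2 * (24 * p * (p + 1) + 2 * p * (32 * p + 2)).
pose K2 := a ^+ 2 * (32 * p + 2) * (2 / sg).
have K10 : 0 <= K1.
  by rewrite mulr_ge0 ?sqr_ge0// addr_ge0// ?mulr_ge0// ?addr_ge0 ?mulr_ge0// ltW.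
have K20 : 0 <= K2.
  apply: mulr_ge0; last by rewrite divr_ge0// ltW.
  by apply: mulr_ge0; [exact: sqr_ge0|lra].
(* [b1] ensures [al * a * (2 * p + 1) <= 1 / 8]; [b2], with [al <= 1], ensures
   [al^2 * K1 <= 1 / 2]. *)
pose b1 := (8 * a * (2 * p + 1))^-1; pose b2 := (2 * K1 + 1)^-1.
have b10 : 0 < b1 by rewrite invr_gt0 !mulr_gt0// addr_gt0// mulr_gt0.
have b20 : 0 < b2 by rewrite invr_gt0 ltr_wpDl// mulr_ge0.
exists (Num.min 1 (Num.min b1 b2)); first by rewrite !lt_min ltr01 b10 b20.
exists (2 * K2); first by rewrite mulr_ge0.
move=> al c k E W Phi al0;
  rewrite !le_min => /and3P[al1 alb1 alb2] c0 E0 WE I1 I2 I3.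
have h1 : al * a * (2 * p + 1) <= 8^-1.
  rewrite (_ : 8^-1 = b1 * (a * (2 * p + 1))); last first.
    by rewrite /b1; field; rewrite !gt_eqF// addr_gt0// mulr_gt0.
  by rewrite -mulrA ler_wpM2r// mulr_ge0 ?ltW// addr_gt0// mulr_gt0.
have h2 : al ^+ 2 * K1 <= 2^-1.
  have : al ^+ 2 <= al by rewrite expr2 ler_piMl.
  have : al * (2 * K1 + 1) <= 1.
    by rewrite -[leRHS](@mulVf _ (2 * K1 + 1)) ?ler_wpM2r// ?gt_eqF// ?ltr_wpDl//
      ?addr_ge0// mulr_ge0.
  move=> u v; have := ler_wpM2r K10 v; lra.
have ks : k ^+ 2 * sg <= 2 / sg * Phi ^+ 2 + 2 * p * E.
  rewrite -(ler_pM2r sg0).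
  rewrite (_ : k ^+ 2 * sg * sg = (k * sg) ^+ 2); last by ring.
  apply: (le_trans I2).
  rewrite [leRHS](_ : _ = 2 * Phi ^+ 2 + 2 * sg * (p * E)); last by field;
    rewrite gt_eqF.
  by rewrite lerD2l ler_wpM2l// mulr_ge0// ltW.
(* With [e = 1 / (16 * p)] the right-hand side contains [E] with coefficient at most
   [1/8 + 2 * p * al * a + al * a + 1/4], hence at most [1/2] by [h1]. *)
have e0 : 0 < (16 * p)^-1 by rewrite invr_gt0 mulr_gt0.
have := I3 _ e0.
have -> : (4 * (16 * p)^-1)^-1 = 4 * p by field; rewrite gt_eqF.
move=> I4.
have h3 : (2 * (16 * p)^-1 + 2 * al * a) * W <= (8^-1 + 2 * p * (al * a)) * E.
  rewrite [leRHS](_ : _ = (2 * (16 * p)^-1 + 2 * al * a) * (p * E));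
    last by field; rewrite gt_eqF.
  rewrite ler_wpM2l// addr_ge0// ?mulr_ge0// ?ltW//; exact: mulr_ge0.
have h4 : (8^-1 + 2 * p * (al * a)) * E + (al * a + 4^-1) * E <= 2^-1 * E.
  rewrite -mulrDl ler_wpM2r//; move: h1; lra.
have h5 : E <= 2
  * (sg * (4 * p * c ^+ 2 + al ^+ 2 * k ^+ 2 * a ^+ 2 * (4 * p + 1))) by lra.
have h6 : 8 * p * (c ^+ 2 * sg)
  <= 8 * p * (3 * al ^+ 2 * a ^+ 2 * ((p + 1) * E + k ^+ 2 * sg)).
  apply: ler_wpM2l; first by rewrite mulr_ge0// ltW.
  apply: (le_trans I1); apply: ler_wpM2l;
    first by rewrite -mulrA mulr_ge0// mulr_ge0// sqr_ge0.
  lra.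
have aa : 0 <= al ^+ 2 * a ^+ 2 by rewrite mulr_ge0 ?sqr_ge0.
have h7 : E <= al ^+ 2 * a ^+ 2
  * (24 * p * (p + 1) * E + (32 * p + 2) * (k ^+ 2 * sg)).
  apply: (le_trans h5); move: h6; lra.
have h8 : (32 * p + 2) * (k ^+ 2 * sg)
  <= (32 * p + 2) * (2 / sg * Phi ^+ 2 + 2 * p * E).
  by rewrite ler_wpM2l// addr_ge0// mulr_ge0// ltW.
have h9 : E <= al ^+ 2 * K1 * E + K2 * al ^+ 2 * Phi ^+ 2.
  apply: (le_trans h7).
  rewrite [leRHS](_ : _ = al ^+ 2 * a ^+ 2 * (24 * p * (p + 1) * E
     + (32 * p + 2) * (2 / sg * Phi ^+ 2 + 2 * p * E))).
    by rewrite ler_wpM2l// lerD2l.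
  by rewrite /K1 /K2; ring.
have : al ^+ 2 * K1 * E <= 2^-1 * E by rewrite ler_wpM2r.
lra.
Qed.

End Absorption.

(** * Limits at the boundary and Cauchy-Schwarz *)

Section WithinLimits.
Variable R : realType.
Implicit Types (S : set (R * R)) (f : R * R -> R) (x : R * R).

Lemma bcont_eq S f g : open S -> (forall x, S x -> f x = g x) -> bcont S f ->
  bcont S g.
Proof.
move=> oS fg [cf [M fM]]; split=> [x Sx|]; last first.
  by exists M => x Sx; rewrite -fg//; exact: fM.
rewrite /prop_for /continuous_at -(fg x Sx).
apply: cvg_trans (cf x Sx); apply: near_eq_cvg.
have : nbhs x S by exact: open_nbhs_nbhs.
by apply: filterS => y /fg ->.
Qed.

Lemma bcontV S f (c : R) : 0 < c -> (forall x, S x -> c <= f x) -> bcont S f ->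
  bcont S (fun x => (f x)^-1).
Proof.
move=> c0 cf [nf _]; split=> [x Sx|].
  by apply: cvgV; [rewrite gt_eqF// (lt_le_trans c0)// cf|exact: nf].
exists c^-1 => x Sx; have fx := cf x Sx.
rewrite normfV gtr0_norm; last exact: lt_le_trans fx.
by rewrite lef_pV2// posrE// (lt_le_trans c0).
Qed.

Lemma within_limit_ge S f x (l : R) : f @ within S (nbhs x) --> l -> 0 <= l ->
  forall e : R, 0 < e -> \forall y \near x, S y -> - e <= f y.
Proof.
move=> fl l0 e e0.
have h : \forall y \near x, S y -> - e < f y by apply: (cvgr_gt _ fl); lra.
by apply: filterS h => y h Sy; exact/ltW/h.
Qed.

Lemma within_closure_cvg S f x : {within closure S, continuous f} ->
  closure S x -> f @ within S (nbhs x) --> f x.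
Proof.
move=> cf cSx; have : f @ within (closure S) (nbhs x) --> f x.
  have := cf x; rewrite /continuous_at; apply: cvg_trans.
  by apply: cvg_app; rewrite nbhs_subspace_in.
apply: cvg_trans; apply: cvg_app => A /= hA.
have {}hA : \forall y \near x, closure S y -> A y := hA.
suff : \forall y \near x, S y -> A y by [].
by apply: filterS hA => y hy Sy; apply: hy; exact: subset_closure.
Qed.

Lemma int2_sqr S f : open S -> bounded_set S -> S !=set0 -> bcont S f ->
  int2 S f ^+ 2 <= int2 S (fun=> 1) * int2 S (fun x => f x ^+ 2).
Proof.
move=> oS bS S0 nf; set sg := int2 S (fun=> 1); set I := int2 S f.
have n1 : bcont S (fun=> 1 : R) by exact: bcont_cst.
have sg0 : 0 < sg by exact: int2_gt0.
have nf2 : bcont S (fun x => f x ^+ 2) by exact: bcontX.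
have key s t :
    0 <= s ^+ 2 * int2 S (fun x => f x ^+ 2) - 2 * s * t * I + t ^+ 2 * sg.
  have -> : s ^+ 2 * int2 S (fun x => f x ^+ 2) - 2 * s * t * I + t ^+ 2 * sg =
      int2 S (fun x => s ^+ 2 * f x ^+ 2 - 2 * s * t * f x + t ^+ 2 * 1).
    have n2 := bcontZ (s ^+ 2) nf2; have nn := bcontZ (2 * s * t) nf.
    have n3 := bcontZ (t ^+ 2) n1.
    by rewrite int2D ?int2B ?int2Z//; exact: bcontB.
  apply: int2_ge0 => x _.
  by rewrite (_ : _ + _ = (s * f x - t) ^+ 2) ?sqr_ge0//; ring.
(* The quadratic form is evaluated at its degenerate direction, [s] the area and [t] the integral of
   [f]. *)
have := key sg I.
rewrite (_ : _ + _ = sg * (sg * int2 S (fun x => f x ^+ 2) - I ^+ 2)); last by ring.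
by rewrite pmulr_rge0// subr_ge0.
Qed.

End WithinLimits.

(** * Integral inequalities for the profile *)

Section Profile.
Variable R : realType.
Local Notation RR := (measurableTypeR R * measurableTypeR R)%type.
Variables (S : set (R * R)) (h : R * R -> R) (H : bool -> R * R -> R)
  (HH : bool -> bool -> R * R -> R) (m : R * R -> R) (M : bool -> R * R -> R).
Hypothesis SD : bounded_smooth_domain S.
Hypothesis Sh : forall x, S x <-> 0 < h x.
Hypotheses (Ch : C1grad setT h H) (CH : forall b, C1grad setT (H b) (HH b))
  (Cm : C1grad setT m M).
Hypothesis m0 : forall x, 0 <= m x.
Hypothesis H0 : forall x, frontier S x -> 0 < dot H H x.

Let oS : open S. Proof. by case: SD. Qed.
Let bS : bounded_set S. Proof. by case: SD. Qed.
Let sT : S `<=` setT. Proof. by []. Qed.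
Let nh := bcont_h oS bS Ch.
Let nH := bcont_H oS bS CH.
Let nHH := bcont_HH oS bS CH.
Let ch x : {for x, continuous h}. Proof. by have [] := Ch (x := x) I. Qed.
Let cH b x : {for x, continuous (H b)}. Proof. by have [] := CH b (x := x) I. Qed.
Let cm x : {for x, continuous m}. Proof. by have [] := Cm (x := x) I. Qed.
Let nm : bcont S m. Proof. exact: bcont_continuous. Qed.
Let nM b : bcont S (M b).
Proof. by apply: bcont_continuous => // x; have [_ /(_ b)[]] := Cm (x := x) I. Qed.

(* On the boundary [zeta . grad h = m]; the summand [h] makes [den] nonzero inside
   the domain, where [grad h] may vanish. *)
Definition den x : R := H false x * H false x + H true x * H true x + h x.
Definition dden b x : R := H false x * HH false b x + HH false b x * H false x +
  (H true x * HH true b x + HH true b x * H true x) + H b x.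
Definition zeta b x : R := m x * H b x * (den x)^-1.
Definition dzeta b b' x : R := m x * H b x * (- (den x)^-1 ^+ 2 * dden b' x) +
  (m x * HH b b' x + M b' x * H b x) * (den x)^-1.

Let den_lb : exists2 c : R, 0 < c & forall x, S x -> c <= den x.
Proof. exact: (nondegenerate oS bS Sh Ch CH H0). Qed.

Let den_neq0 x : S x -> den x != 0.
Proof. by have [c c0 hc] := den_lb; move=> /hc /(lt_le_trans c0) /gt_eqF ->. Qed.

Lemma C1grad_zeta b : C1grad S (zeta b) (dzeta b).
Proof.
have Cd : C1grad S den dden.
  apply: (@C1grad_sub _ setT) => //; apply: C1gradD => //.
  by apply: C1gradD; exact: C1gradM.
apply: C1gradM; last exact: C1gradV.
by apply: (@C1grad_sub _ setT) => //; exact: C1gradM.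
Qed.

Let nden : bcont S (fun x => (den x)^-1).
Proof.
have [c c0 hc] := den_lb; apply: (bcontV c0 hc).
by apply: bcontD => //; exact: bcont_dot.
Qed.

Lemma bcont_zeta b : bcont S (zeta b).
Proof. by apply: bcontM => //; exact: bcontM. Qed.

Lemma bcont_div_zeta : bcont S (div dzeta).
Proof.
have nd b : bcont S (dden b).
  by apply: bcontD => //; apply: bcontD; apply: bcontD; exact: bcontM.
have nz b b' : bcont S (dzeta b b').
  apply: bcontD; apply: bcontM => //.
  - exact: bcontM.
  - by apply: bcontM => //; apply: bcontN; exact: bcontX.
  - by apply: bcontD; exact: bcontM.
by apply: bcontD.
Qed.

Lemma zeta_limit x b : frontier S x ->
  zeta b @ within S (nbhs x) --> m x * H b x * (dot H H x)^-1.
Proof.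
move=> fx; have hx := frontier_h0 oS Sh Ch fx.
apply: cvg_within_filter.
apply: cvgM; first by apply: cvgM; [exact: cm|exact: cH].
apply: cvgV; first by rewrite gt_eqF// H0.
rewrite -[X in _ --> X]addr0 -hx; apply: cvgD; last exact: ch.
by apply: cvgD; apply: cvgM; exact: cH.
Qed.

Section Fixed.
Variables (al Phi c : R) (P : R * R -> R) (V : bool -> R * R -> R)
  (VV : bool -> bool -> R * R -> R) (L : bool -> R * R -> R).
Hypothesis al0 : 0 <= al.
Hypotheses (CP : C1grad S P V) (CV : forall b, C1grad S (V b) (VV b)).
Hypothesis div_VV : forall x, S x -> div VV x = - c.
Hypothesis P_limit : forall x, closure S x -> P @ within S (nbhs x) --> P x.
Hypothesis V_limit : forall b x, closure S x -> V b @ within S (nbhs x) --> L b x.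
Hypothesis robin : forall x, frontier S x ->
  H false x * L false x + H true x * L true x = m x * (al * P x).
Hypothesis int_P : int2 S P = Phi.

Let nP : bcont S P.
Proof. by apply: bcont_limit P_limit => // x Sx; have [] := CP Sx. Qed.

Let nV b : bcont S (V b).
Proof. by apply: bcont_limit (@V_limit b) => // x Sx; have [] := CV b Sx. Qed.

Let E := int2 S (dot V V).
Let ndVV : bcont S (dot V V). Proof. exact: bcont_dot. Qed.
Let ndVH : bcont S (dot V H). Proof. exact: bcont_dot. Qed.
Let ndVz : bcont S (dot V zeta).
Proof. by apply: bcont_dot => //; exact: bcont_zeta. Qed.
Let ndz := bcont_div_zeta.

Let cvg_in (f : R * R -> R) (x : R * R) : {for x, continuous f} ->
  f @ within S (nbhs x) --> f x.
Proof. exact: cvg_within_filter. Qed.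

(* [divergence_le0] for the field [(P - 2 lam h) grad P]. *)
Lemma energy_inequality (lam : R) :
  E - 2 * lam * int2 S (dot V H) - c * Phi + 2 * lam * c * int2 S h <= 0.
Proof.
pose f x := P x - 2 * lam * h x.
have Cf : C1grad S f (fun b x => V b x - 2 * lam * H b x).
  by apply: C1gradB; [exact: CP|apply: C1gradZ; exact: C1grad_sub Ch].
have nf : bcont S f by apply: bcontB => //; exact: bcontZ.
pose YG b b' x := f x * VV b b' x + (V b' x - 2 * lam * H b' x) * V b x.
have CY b : C1grad S (fun x => f x * V b x) (YG b) by exact: C1gradM Cf (CV b).
have nY b : bcont S (fun x => f x * V b x) by exact: bcontM.
pose g x := dot V V x - 2 * lam * dot V H x - c * P x + 2 * lam * c * h x.
have divE x : S x -> g x = div YG x.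
  move=> Sx; have := div_VV Sx; rewrite /div => dx.
  rewrite /g /YG /div.
  rewrite [RHS](_ : _ = f x * (VV false false x + VV true true x) + dot V V x
    - 2 * lam * dot V H x); last by rewrite /dot; ring.
  by rewrite dx /f; ring.
have n1 := bcontZ (2 * lam) ndVH; have n2 := bcontZ c nP.
have n3 := bcontZ (2 * lam * c) nh; have n4 := bcontB ndVV n1; have n5 :=
  bcontB n4 n2.
have ng : bcont S g by exact: bcontD.
rewrite [leLHS](_ : _ = int2 S (div YG)).
  apply: (divergence_le0 oS bS Sh Ch CH H0 CY nY); first exact: bcont_eq divE ng.
  move=> x e fx e0; have cSx := fx.1.
  have hx := frontier_h0 oS Sh Ch fx.
  (* As [h = 0] on the frontier, the Robin condition makes the flux tend to [al * m * P^2], which is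
     nonnegative. *)
  apply: within_limit_ge e0; last first.
    have h0 : 0 <= P x * (m x * (al * P x)).
      rewrite (_ : _ * _ = al * m x * P x ^+ 2); last by ring.
      by rewrite mulr_ge0 ?sqr_ge0// mulr_ge0.
    rewrite -(robin fx) in h0; exact: h0.
  rewrite (_ : P x * _ = H false x * ((P x - 2 * lam * h x) * L false x)
    + H true x * ((P x - 2 * lam * h x) * L true x)); last first.
    by rewrite hx; ring.
  have cf : f @ within S (nbhs x) --> P x - 2 * lam * h x.
    apply: cvgB; first exact: P_limit.
    by apply: cvgM; [exact: cvg_cst|exact: cvg_in].
  by apply: cvgD; apply: cvgM; [exact: cvg_in|apply: cvgM => //; exact: V_limit|
    exact: cvg_in|apply: cvgM => //; exact: V_limit].
rewrite -(int2_eq divE) /g (int2D oS bS n5 n3) (int2B oS bS n4 n2)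
  (int2B oS bS ndVV n1).
by rewrite !int2Z// int_P -/E; ring.
Qed.

(* [divergence_le0] for the field [(kap P + k0) (grad P - al P zeta)], which is
   tangential on the boundary. *)
Lemma weighted_inequality (kap k0 : R) :
  int2 S (fun x =>
    (kap * P x + k0) * (- c - al * (P x * div dzeta x + dot V zeta x))
    + kap * (dot V V x - al * (P x * dot V zeta x))) <= 0.
Proof.
pose f x := kap * P x + k0.
have Cf : C1grad S f (fun b x => kap * V b x + 0).
  by apply: C1gradD; [apply: C1gradZ; exact: CP|exact: C1grad_cst].
have nf : bcont S f by apply: bcontD; [exact: bcontZ|exact: bcont_cst].
pose Z b x := V b x - al * (P x * zeta b x).
have CZ b : C1grad S (Z b) (fun b' x =>
  VV b b' x - al * (P x * dzeta b b' x + V b' x * zeta b x)).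
  apply: C1gradB; first exact: CV.
  by apply: C1gradZ; apply: C1gradM; [exact: CP|exact: C1grad_zeta].
have nZ b : bcont S (Z b).
  by apply: bcontB => //; apply: bcontZ; apply: bcontM => //; exact: bcont_zeta.
pose YG b b' x := f x * (VV b b' x - al * (P x * dzeta b b' x + V b' x * zeta b x))
  + (kap * V b' x + 0) * Z b x.
have CY b : C1grad S (fun x => f x * Z b x) (YG b) by exact: C1gradM Cf (CZ b).
have nY b : bcont S (fun x => f x * Z b x) by exact: bcontM.
pose g x := (kap * P x + k0) * (- c - al * (P x * div dzeta x + dot V zeta x))
    + kap * (dot V V x - al * (P x * dot V zeta x)).
have divE x : S x -> g x = div YG x.
  move=> Sx; have := div_VV Sx; rewrite /div => dx.
  rewrite /g /YG /div.
  rewrite [RHS](_ : _ = f x * ((VV false false x + VV true true x)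
     - al * (P x * (dzeta false false x + dzeta true true x) + dot V zeta x))
     + kap * (dot V V x - al * (P x * dot V zeta x))); last by rewrite /dot /Z;
       ring.
  by rewrite dx /f.
have ng : bcont S g.
  apply: bcontD.
    apply: bcontM => //; apply: bcontB; first exact: bcont_cst.
    by apply: bcontZ; apply: bcontD => //; exact: bcontM.
  by apply: bcontZ; apply: bcontB => //; apply: bcontZ; exact: bcontM.
rewrite (int2_eq divE : _ = int2 S (div YG)).
apply: (divergence_le0 oS bS Sh Ch CH H0 CY nY); first exact: bcont_eq divE ng.
move=> x e fx e0; have cSx := fx.1.
have hx := frontier_h0 oS Sh Ch fx.
apply: within_limit_ge e0; last exact: lexx.
have d0 : dot H H x != 0 by rewrite gt_eqF// H0.
pose z b := m x * H b x * (dot H H x)^-1.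
have -> : 0 = H false x * ((kap * P x + k0) * (L false x - al * (P x * z false)))
    + H true x * ((kap * P x + k0) * (L true x - al * (P x * z true))).
  rewrite (_ : _ + _
    = (kap * P x + k0) * ((H false x * L false x + H true x * L true x)
    - al * P x * (m x * (dot H H x * (dot H H x)^-1)))); last first.
    by rewrite /z; move: (dot H H x)^-1 => D; rewrite /dot; ring.
  by rewrite robin// mulfV//; ring.
have cf : f @ within S (nbhs x) --> kap * P x + k0.
  apply: cvgD; last exact: cvg_cst.
  by apply: cvgM; [exact: cvg_cst|exact: P_limit].
have cZ b : Z b @ within S (nbhs x) --> L b x - al * (P x * z b).
  apply: cvgB; first exact: V_limit.
  apply: cvgM; first exact: cvg_cst.
  by apply: cvgM; [exact: P_limit|exact: zeta_limit].
by apply: cvgD; apply: cvgM; [exact: cvg_in|exact: cvgM|exact: cvg_in|exact: cvgM].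
Qed.

Let E0 : 0 <= E.
Proof. by apply: int2_ge0 => x _; rewrite addr_ge0// -expr2 sqr_ge0. Qed.

Lemma energy_le_flux : E <= c * Phi.
Proof. by have := energy_inequality 0;
  rewrite !(mulr0, mul0r) subr0 addr0 subr_le0. Qed.

(** [h] is the fixed test function vanishing on the boundary. In [energy_inequality] with
    [lam = c * t], the square of [V - c * t * H] removes [E] at the cost of [(c * t)^2] times the
    integral of [dot H H]; the condition on [t] lets half of the term in [h] pay for it. *)
Lemma pressure_le (t : R) : 0 < c -> t * int2 S (dot H H) <= int2 S h ->
  0 <= t -> c * (t * int2 S h) <= Phi.
Proof.
move=> c0 tG t0.
have sq : 0 <= E - 2 * (c * t) * int2 S (dot V H) + (c * t) ^+ 2 * int2 S (dot H H).
  have ndHH : bcont S (dot H H) by exact: bcont_dot.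
  have n1 := bcontZ (2 * (c * t)) ndVH; have n2 := bcontZ ((c * t) ^+ 2) ndHH.
  rewrite -[2 * _ * _]int2Z// -[_ ^+ 2 * _]int2Z// -(int2B oS bS ndVV n1).
  rewrite -(int2D oS bS (bcontB ndVV n1) n2); apply: int2_ge0 => x _.
  rewrite (_ : _ + _
    = (V false x - c * t * H false x) ^+ 2 + (V true x - c * t * H true x) ^+ 2).
    by rewrite addr_ge0// sqr_ge0.
  by rewrite /dot; ring.
have ie := energy_inequality (c * t).
have h1 : (c * t) ^+ 2 * int2 S (dot H H) <= c ^+ 2 * t * int2 S h.
  rewrite [leLHS](_ : _ = c ^+ 2 * t * (t * int2 S (dot H H))); last by ring.
  by rewrite ler_wpM2l// mulr_ge0// sqr_ge0.
rewrite -(ler_pM2l c0); move: h1 ie sq; lra.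
Qed.

(** * Estimates for small friction *)

Section Estimates.
Variables (a k : R).
Hypotheses (a0 : 0 < a) (c0 : 0 <= c) (S0 : S !=set0).
Hypothesis da : forall x, S x -> `|div dzeta x| <= a.
Hypothesis za : forall x, S x -> dot zeta zeta x <= a ^+ 2.

Let W := int2 S (fun x => (P x - k) ^+ 2).
Let sg := int2 S (fun=> 1).
Let n1 : bcont S (fun=> 1 : R). Proof. exact: bcont_cst. Qed.
Let sg0 : 0 < sg. Proof. exact: int2_gt0. Qed.
Let nw : bcont S (fun x => P x - k).
Proof. by apply: bcontB => //; exact: bcont_cst. Qed.
Let nw2 : bcont S (fun x => (P x - k) ^+ 2). Proof. exact: bcontX. Qed.

Let zV x : S x -> dot V zeta x ^+ 2 <= a ^+ 2 * dot V V x.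
Proof.
move=> Sx; apply: (@le_trans _ _ (dot zeta zeta x * dot V V x)).
  rewrite -subr_ge0 (_ : _ - _
    = (V false x * zeta true x - V true x * zeta false x) ^+ 2).
    exact: sqr_ge0.
  by rewrite /dot; ring.
by rewrite ler_wpM2r ?za// addr_ge0// -expr2 sqr_ge0.
Qed.

Let d2 x : S x -> div dzeta x ^+ 2 <= a ^+ 2.
Proof. by move=> /da hd;
  rewrite -[leLHS]ger0_norm ?sqr_ge0// normrX lerXn2r// nnegrE ltW. Qed.

Let nPdz : bcont S (fun x => P x * div dzeta x + dot V zeta x).
Proof. by apply: bcontD => //; exact: bcontM. Qed.

(** The weight [-1] gives [c * sg <= - (al * J)], so the constant [c] is of order [al].
    Cauchy-Schwarz follows, and the factor 3 comes from squaring three terms after writing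
    [P = (P - k) + k]. *)
Lemma pressure_sqr_le :
  c ^+ 2 * sg <= 3 * al ^+ 2 * a ^+ 2 * (W + k ^+ 2 * sg + E).
Proof.
set J := int2 S (fun x => P x * div dzeta x + dot V zeta x).
have h1 : c * sg <= - (al * J).
  have := weighted_inequality 0 (-1).
  rewrite (_ : int2 S _ = c * sg + al * J); first lra.
  rewrite /sg /J -!int2Z// -int2D//; try exact: bcontZ.
  by apply: int2_eq => x _; ring.
have h2 : (c * sg) ^+ 2 <= (al * J) ^+ 2.
  have cs0 : 0 <= c * sg by apply: mulr_ge0 => //; exact: ltW.
  rewrite -[leRHS]sqrrN lerXn2r ?nnegrE//; exact: le_trans cs0 h1.
have h3 : J ^+ 2 <= sg * int2 S (fun x => (P x * div dzeta x + dot V zeta x) ^+ 2).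
  exact: int2_sqr.
have h4 : int2 S (fun x => (P x * div dzeta x + dot V zeta x) ^+ 2) <=
    3 * a ^+ 2 * (W + k ^+ 2 * sg + E).
  have nk : bcont S (fun x => k ^+ 2 * 1) by exact: bcontZ.
  rewrite /W /sg /E -int2Z// -int2D// -int2D//; last exact: bcontD.
  rewrite -int2Z//; last by apply: bcontD => //; exact: bcontD.
  apply: int2_le => //; first exact: bcontX.
    by apply: bcontZ; apply: bcontD => //; exact: bcontD.
  move=> x Sx; have hd := d2 Sx; have hz := zV Sx.
  have h5 : (P x - k) ^+ 2 * div dzeta x ^+ 2 <= (P x - k) ^+ 2 * a ^+ 2.
    by rewrite ler_wpM2l// sqr_ge0.
  have h6 : k ^+ 2 * div dzeta x ^+ 2 <= k ^+ 2 * a ^+ 2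
    by rewrite ler_wpM2l// sqr_ge0.
  move: (div dzeta x) (dot V zeta x) (dot V V x) (P x) hd hz h5 h6 =>
    d z D p hd hz h5 h6.
  have s1 := sqr_ge0 ((p - k) * d - k * d).
  have s2 := sqr_ge0 ((p - k) * d - z); have s3 := sqr_ge0 (k * d - z).
  move: s1 s2 s3; lra.
rewrite -(ler_pM2l sg0) (_ : sg * _ = (c * sg) ^+ 2); last by ring.
apply: (le_trans h2); rewrite exprMn.
rewrite [leRHS](_ : _ = al ^+ 2 * (sg * (3 * a ^+ 2 * (W + k ^+ 2 * sg + E))));
  last by ring.
apply: ler_wpM2l; first exact: sqr_ge0.
by apply: (le_trans h3); rewrite ler_pM2l.
Qed.

(** Since [k] need not be the mean of [P], its size is recovered from the flux: [k * sg] is [Phi]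
    minus the integral of [P - k]. *)
Lemma mean_sqr_le : (k * sg) ^+ 2 <= 2 * Phi ^+ 2 + 2 * sg * W.
Proof.
have -> : k * sg = Phi - int2 S (fun x => P x - k).
  rewrite (int2B oS bS nP (bcont_cst S k)) int_P (int2_cst oS bS k) -/sg; ring.
have : int2 S (fun x => P x - k) ^+ 2 <= sg * W by exact: int2_sqr.
have := sqr_ge0 (Phi + int2 S (fun x => P x - k)).
lra.
Qed.

(** The weight is [P - k]. The parameter [e] stays free so that [absorption] can fit it to the
    Poincare constant. *)
Lemma energy_split (e : R) : 0 < e ->
  E <= (2 * e + 2 * al * a) * W + (al * a + 4^-1) * E
      + sg * (c ^+ 2 / (4 * e) + al ^+ 2 * k ^+ 2 * a ^+ 2 * ((4 * e)^-1 + 1)).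
Proof.
move=> e0; have wi := weighted_inequality 1 (- k).
set g := fun x => _ in wi.
set u := 2 * e + 2 * al * a; set v := al * a + 4^-1.
set r := c ^+ 2 / (4 * e) + _.
have ng : bcont S g.
  apply: bcontD.
    apply: bcontM; first by apply: bcontD; [exact: bcontZ|exact: bcont_cst].
    by apply: bcontB; [exact: bcont_cst|exact: bcontZ].
  by apply: bcontZ; apply: bcontB => //; apply: bcontZ; exact: bcontM.
have nu := bcontZ u nw2; have nv := bcontZ v ndVV; have nr := bcont_cst S r.
have nuv := bcontD nu nv; have nuvr := bcontD nuv nr.
have : E <= int2 S (fun x => g x + (u * (P x - k) ^+ 2 + v * dot V V x + r)).
  apply: int2_le => //; first exact: bcontD.
  move=> x Sx; have hd := da Sx; have hd2 := d2 Sx; have hz := zV Sx.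
  rewrite /g /u /v /r {ng nu nv nr nuv nuvr g u v r wi}.
  (* With [w = P x - k] the terms to be bounded are [c * w], [al * k * w * d], [al * w^2 * d],
     [2 * al * w * z] and [al * k * z]; [f1] to [f5] treat them in this order by Young's
     inequality. *)
  have [w Pw] : exists w, P x = w + k by exists (P x - k); rewrite subrK.
  rewrite Pw mul1r addrK.
  move: (div dzeta x) (dot V zeta x) (dot V V x) hd hd2 hz => d z D hd hd2 hz.
  have f1 : c * w <= e * w ^+ 2 + c ^+ 2 / (4 * e).
    rewrite -subr_ge0 (_ : _ - _ = e * (w - c / (2 * e)) ^+ 2); last by field;
      rewrite gt_eqF.
    by rewrite mulr_ge0 ?sqr_ge0// ltW.
  have f2 : al * k * w * d <= e * w ^+ 2 + al ^+ 2 * k ^+ 2 * a ^+ 2 / (4 * e).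
    apply: (@le_trans _ _ (e * w ^+ 2 + al ^+ 2 * k ^+ 2 * d ^+ 2 / (4 * e))).
      rewrite -subr_ge0 (_ : _ - _ = e * (w - al * k * d / (2 * e)) ^+ 2);
        last by field; rewrite gt_eqF.
      by rewrite mulr_ge0 ?sqr_ge0// ltW.
    rewrite lerD2l; apply: ler_wpM2r; first by rewrite invr_ge0 mulr_ge0// ltW.
    by apply: ler_wpM2l => //; rewrite mulr_ge0 ?sqr_ge0.
  have f3 : al * w ^+ 2 * d <= al * a * w ^+ 2.
    rewrite mulrAC ler_wpM2r ?sqr_ge0// ler_wpM2l//.
    exact: le_trans (ler_norm _) hd.
  have zD : z ^+ 2 / a <= a * D by rewrite ler_pdivrMr//; move: hz; lra.
  have f4 : 2 * al * w * z <= al * a * w ^+ 2 + al * a * D.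
    apply: (@le_trans _ _ (al * (a * w ^+ 2 + z ^+ 2 / a))).
      rewrite -subr_ge0 (_ : _ - _ = al * (a * (w - z / a) ^+ 2)); last by field;
        rewrite gt_eqF.
      by rewrite mulr_ge0// mulr_ge0 ?sqr_ge0// ltW.
    have := ler_wpM2l al0 zD; lra.
  have f5 : al * k * z <= 4^-1 * D + al ^+ 2 * k ^+ 2 * a ^+ 2.
    apply: (@le_trans _ _ (4^-1 * (z ^+ 2 / a / a) + al ^+ 2 * k ^+ 2 * a ^+ 2)).
      rewrite -subr_ge0 (_ : _ - _ = (z / (2 * a) - al * k * a) ^+ 2) ?sqr_ge0//.
      by field; rewrite gt_eqF.
    rewrite lerD2r ler_wpM2l// ler_pdivrMr//; move: zD; lra.
  move: f1 f2 f3 f4 f5; lra.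
rewrite (int2D oS bS ng nuvr) (int2D oS bS nuv nr) (int2D oS bS nu nv) !int2Z//.
rewrite (int2_cst oS bS r) -/W -/E -/sg; move: wi; lra.
Qed.

End Estimates.
End Fixed.
End Profile.

Section FinalNorm.
Variable R : realType.
Local Notation RR := (measurableTypeR R * measurableTypeR R)%type.

Lemma L2norm_grad_le (S : set (R * R)) (P : R * R -> R) (C : R) : open S ->
  bounded_set S ->
  (forall b, bcont S (partial b P)) -> 0 <= C ->
  int2 S (dot (fun b => partial b P) (fun b => partial b P)) <= C ^+ 2 ->
  (L2norm_grad S P <= C%:E)%E.
Proof.
move=> oS bS nV C0 EC.
set V := fun b => partial b P in EC.
have nD : bcont S (dot V V) by exact: bcont_dot.
have D0 x : 0 <= dot V V x by rewrite addr_ge0// -expr2 sqr_ge0.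
rewrite /L2norm_grad unlock.
rewrite (_ : (\int[_]_x _)%E = (int2 S (dot V V))%:E).
  rewrite poweR_EFin lee_fin powR12_sqrt; last by exact: int2_ge0.
  by rewrite -[leRHS]ger0_norm// -sqrtr_sqr ler_sqrt// sqr_ge0.
rewrite -int2_EFin// [RHS]integral_mkcond; apply: eq_integral => x _.
rewrite !patchE; case: ifPn => xS; last by rewrite abse0 poweR_EFin powR0.
rewrite abse_EFin poweR_EFin; congr EFin.
rewrite ger0_norm ?sqrtr_ge0// powR_mulrn ?sqrtr_ge0// sqr_sqrtr.
  by rewrite /dot !expr2.
by rewrite addr_ge0// sqr_ge0.
Qed.

End FinalNorm.

Theorem proposition3p1 (R : realType) (Sigma : set (R * R))
    (hSigma : bounded_smooth_domain Sigma) :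
  exists2 C : R, 0 < C &
    forall (Phi alpha : R) (P : R * R -> R),
      0 <= Phi -> 0 <= alpha -> poiseuille_profile Sigma alpha Phi P ->
      (L2norm_grad Sigma P <= (C * alpha * Phi / (1 + alpha))%:E)%E.
Proof.
have [S0 oS kS bS _] := hSigma.
have [h [H [HH [m [M [Sh [Ch CH Cm] m0 H0 mN]]]]]] := defining_function hSigma.
have nz := bcont_zeta hSigma Sh Ch CH Cm H0.
have [M1 hM1] := (bcont_div_zeta hSigma Sh Ch CH Cm H0).2.
have [M2 hM2] : exists N, forall x, Sigma x ->
  `|dot (zeta h H m) (zeta h H m) x| <= N.
  by case: (bcont_dot nz nz).
(* One constant for both bounds: [a^2] dominates [M2] because [a] is at least 1 and at least
   [|M2|]. *)
pose a : R := `|M1| + `|M2| + 1.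
have a0 : 0 < a by rewrite ltr_pwDr// addr_ge0.
have da x : Sigma x -> `|div (dzeta h H HH m M) x| <= a.
  move=> /hM1/le_trans; apply; have := ler_norm M1; have := normr_ge0 M2.
  by rewrite /a; lra.
have za x : Sigma x -> dot (zeta h H m) (zeta h H m) x <= a ^+ 2.
  move=> /hM2 hx; apply: (le_trans (ler_norm _)); apply: (le_trans hx).
  have := ler_norm M2; have := normr_ge0 M1; have := normr_ge0 M2; rewrite /a; nra.
have [Cp Cp0 hP] := poincare_domain oS bS kS S0 Sh Ch CH H0.
(* The factor 2 is there because the Poincare inequality will be used with [T = 2 * E]. *)
have p1 : 1 <= 2 * Cp + 1 by rewrite lerDr mulr_ge0.
have sg0 : 0 < int2 Sigma (fun=> 1) by apply: int2_gt0 => //; exact: bcont_cst.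
have [al0 al00 [K K0 hK]] := absorption a0 p1 sg0.
have Ih : 0 < int2 Sigma h.
  by apply: int2_gt0 => //; [exact: bcont_h oS bS Ch|move=> x /Sh].
have G0 : 0 <= int2 Sigma (dot H H).
  by apply: int2_ge0 => x _; rewrite addr_ge0// -expr2 sqr_ge0.
pose t := int2 Sigma h / (int2 Sigma (dot H H) + 1).
have t0 : 0 < t by rewrite divr_gt0// ltr_wpDl.
have tG : t * int2 Sigma (dot H H) <= int2 Sigma h.
  rewrite /t mulrAC ler_pdivrMr ?ltr_wpDl// ler_pM2l// lerDl//.
pose B := t * int2 Sigma h.
have B0 : 0 < B by rewrite mulr_gt0.
(* One summand for [al <= al0], one for [al > al0], and 1 so that [C * X^2 <= (C * X)^2] for the
   ratio [X = al * Phi / (1 + al)]. *)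
pose C := K * (1 + al0) ^+ 2 + B^-1 * ((1 + al0) / al0) ^+ 2 + 1.
have C1 : 1 <= C.
  by rewrite /C lerDr addr_ge0// mulr_ge0// ?sqr_ge0// invr_ge0 ltW.
exists C; first exact: lt_le_trans C1.
move=> Phi al P Phi0 alge0 PP.
have [[/C1_inP CP CV] [_ cP cV] [c Pc] rb iP] := PP.
have P_limit x : closure Sigma x -> P @ within Sigma (nbhs x) --> P x.
  exact: within_closure_cvg.
pose V b : R * R -> R := partial b P.
pose VV b b' : R * R -> R := partial b' (partial b P).
pose L b (x : R * R) : R := lim (V b @ within Sigma (nbhs x)).
have CV' b : C1grad Sigma (V b) (VV b) by have /C1_inP := CV b.
have V_limit b (x : R * R) : closure Sigma x -> V b @ within Sigma (nbhs x) -->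
  L b x.
  by move=> cSx; exact: cV.
have dVV x : Sigma x -> div VV x = - c by move=> /Pc <-; rewrite opprK.
have robin x : frontier Sigma x ->
    H false x * L false x + H true x * L true x = m x * (al * P x).
  move=> fx; apply: (mN x (L^~ x)) => // n un.
  by rewrite -(rb x n fx un).
have nP : bcont Sigma P by apply: bcont_limit P_limit => // x Sx;
  have [] := CP x Sx.
have nV b : bcont Sigma (V b).
  by apply: bcont_limit (V_limit b) => // x Sx; have [] := CV' b x Sx.
have iP' : int2 Sigma P = Phi by apply: EFin_inj; rewrite -int2_EFin.
pose X := al * Phi / (1 + al).
have al1 : 0 < 1 + al by rewrite ltr_wpDr.
have X0 : 0 <= X by rewrite divr_ge0 ?mulr_ge0// ltW.
rewrite (_ : C * al * Phi / (1 + al) = C * X); last by rewrite /X; ring.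
have C0 : 0 <= C by apply: le_trans C1.
apply: L2norm_grad_le => //; first exact: mulr_ge0.
rewrite -/V.
suff EX : int2 Sigma (dot V V) <= C * X ^+ 2.
  apply: (le_trans EX); rewrite [leRHS]exprMn ler_wpM2r ?sqr_ge0//.
  by rewrite expr2 ler_peMl.
set E := int2 _ _.
have E0 : 0 <= E by apply: int2_ge0 => x _; rewrite addr_ge0// -expr2 sqr_ge0.
have Ec : E <= c * Phi.
  exact: (energy_le_flux hSigma Sh Ch CH m0 H0 alge0 CP CV' dVV P_limit V_limit
    robin iP').
have [c0|c0] := leP c 0.
  apply: (le_trans Ec); apply: (@le_trans _ _ 0); first by rewrite mulr_le0_ge0.
  by rewrite mulr_ge0// sqr_ge0.
have [le_al|lt_al] := leP al al0.
  have EK : E <= K * al ^+ 2 * Phi ^+ 2.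
    (* The Poincare inequality needs a strict bound on the energy: [2 * E] is one unless [E = 0],
       which is trivial. *)
    move: E0; rewrite le_eqVlt => /predU1P[<-|Ep].
      by rewrite mulr_ge0 ?mulr_ge0 ?sqr_ge0.
    have [|k hk] := hP P V CP nP nV (2 * E); first by rewrite -/E; lra.
    apply: (hK al c k E (int2 Sigma (fun x => (P x - k) ^+ 2)) Phi) => //.
    - exact: ltW.
    - exact: ltW.
    - move: hk; lra.
    - exact: (pressure_sqr_le hSigma Sh Ch CH Cm H0 CP CV' dVV P_limit V_limit
      robin k a0 (ltW c0) S0 da za).
    - exact: (mean_sqr_le hSigma CP P_limit iP' k S0).
    - move=> e e0.
      exact: (energy_split hSigma Sh Ch CH Cm H0 alge0 CP CV' dVV P_limit V_limit
        robin k a0 da za e0).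
  apply: (le_trans EK).
  rewrite (_ : K * al ^+ 2 * Phi ^+ 2 = K * (1 + al) ^+ 2 * X ^+ 2); last first.
    by rewrite /X; field; rewrite gt_eqF.
  apply: ler_wpM2r; first exact: sqr_ge0.
  rewrite /C -addrA; apply: ler_wpDr.
    by rewrite addr_ge0// mulr_ge0 ?sqr_ge0// invr_ge0 ltW.
  rewrite ler_wpM2l// lerXn2r// ?nnegrE ?addr_ge0// ?lerD2l//.
  exact: ltW.
have al_gt0 : 0 < al by exact: lt_trans lt_al.
have cB : c * B <= Phi.
  exact: (pressure_le hSigma Sh Ch CH m0 H0 alge0 CP CV' dVV P_limit V_limit robin
    iP' c0 tG (ltW t0)).
(* For large friction [E <= c * Phi <= Phi^2 / B], and [Phi = (1 + al) / al * X], where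
   [(1 + al) / al] decreases in [al] and is bounded by its value at [al0]. *)
apply: (@le_trans _ _ (B^-1 * Phi ^+ 2)).
  apply: (le_trans Ec); rewrite expr2 mulrA ler_wpM2r//.
  by rewrite mulrC ler_pdivlMr.
rewrite (_ : Phi = (1 + al) / al * X); last first.
  by rewrite /X; field; rewrite !gt_eqF.
rewrite exprMn mulrA; apply: ler_wpM2r; first exact: sqr_ge0.
rewrite /C addrAC; apply: ler_wpDl; first by rewrite addr_ge0// mulr_ge0// sqr_ge0.
apply: ler_wpM2l; first by rewrite invr_ge0 ltW.
have r0 (x : R) : 0 < x -> 0 <= (1 + x) / x by move=> x0;
  rewrite divr_ge0 ?addr_ge0// ltW.
apply: lerXn2r; rewrite ?nnegrE ?r0//.
rewrite !mulrDl !divff ?gt_eqF// lerD2r !div1r lef_pV2// ?posrE//.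
exact: ltW.
Qed.
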